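(* Let $G$ be a countable discrete group that contains a nonabelian free group as a subgroup. Then every pair of nontrivial Bernoulli shifts over $G$ are weakly isomorphic. That is, if $(K,\kappa)$ and $(L,\lambda)$ are standard Borel probability spaces such that neither $\kappa$ nor $\lambda$ is supported on a single point, then there exist a factor map from $(G,K^G,\kappa^G)$ to $(G,L^G,\lambda^G)$ and a factor map from $(G,L^G,\lambda^G)$ to $(G,K^G,\kappa^G)$.
   Context: A dynamical system over a countable discrete group $G$ (a $G$-system) is a triple $(G,X,\mu)$ where $(X,\mu)$ is a probability space on which $G$ acts by measure-preserving transformations. A factor map from $(G,X,\mu)$ to $(G,Y,\nu)$ is a measurable map $\phi:X'\to Y$, defined on a $G$-invariant measurable subset $X'\subset X$ with $\mu(X')=1$, such that $\phi(gx)=g\phi(x)$ for all $x\in X'$, $g\in G$, and $\phi_*\mu=\nu$. Two $G$-systems are weakly isomorphic if there exist factor maps in both directions between them. For a standard Borel probability space $(K,\kappa)$, let $K^G$ be the set of all functions $x:G\to K$ with the product Borel structure, and $\kappa^G$ the product measure. $G$ acts on $K^G$ by $(gx)(f)=x(g^{-1}f)$ for $x\in K^G$, $g,f\in G$. The system $(G,K^G,\kappa^G)$ is the Bernoulli shift over $G$ with base $(K,\kappa)$. It is nontrivial if $\kappa$ is not supported on a single point. *)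

(* Defs.v *)
From HB Require Import structures.
From mathcomp Require Import all_boot all_order all_algebra.
From mathcomp Require Import all_classical all_reals all_analysis.
From mathcomp Require Import measurable_realfun.

Set Implicit Arguments.
Unset Strict Implicit.
Unset Printing Implicit Defensive.

Import Order.TTheory GRing.Theory Num.Theory.
Local Open Scope classical_set_scope.
Local Open Scope ring_scope.
Local Open Scope ereal_scope.

#[short(type="countGroupType")]
HB.structure Definition CountGroup := {G of Group G & Countable G}.

Definition coordinate_sets (I : Type) d (K : measurableType d) :
    set (set (I -> K)) :=
  \bigcup_(i in [set: I]) preimage_set_system setT (fun x : I -> K => x i) measurable.
Arguments coordinate_sets I {d} K.

Definition prod_space (I : Type) d (K : measurableType d) : Type :=
  g_sigma_algebraType (coordinate_sets I K).
Arguments prod_space I {d} K.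

Definition prod_space_display (I : Type) d (K : measurableType d) :=
  sigma_display (coordinate_sets I K).
Arguments prod_space_display I {d} K.

HB.instance Definition _ (I : Type) d (K : measurableType d) :=
  Measurable.copy (prod_space I K) (g_sigma_algebraType (coordinate_sets I K)).

Lemma measurable_coord (I : Type) d (K : measurableType d) (i : I) :
  measurable_fun setT (fun x : prod_space I K => x i).
Proof.
move=> _ B mB; apply: sub_sigma_algebra; exists i => //.
by exists B.
Qed.

Lemma measurable_to_prod (I : Type) d (K : measurableType d) d' (T : measurableType d')
    (f : T -> prod_space I K) :
  (forall i, measurable_fun setT (fun t => f t i)) -> measurable_fun setT f.
Proof.
move=> mf; apply: (@measurability _ _ T (prod_space I K) setT f (coordinate_sets I K) erefl).
move=> _ [_ [i _ [B mB <-]] <-].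
rewrite setTI setTI; have := mf i measurableT B mB; by rewrite setTI.
Qed.

Section product_probability.
Context (R : realType) (I : countType) d (K : measurableType d).
Variable kappa : probability K R.
Notation X := (prod_space I K).

(* [A] depends only on the coordinates of index (by [pickle]) less than [n] *)
Definition below (n : nat) (A : set X) : Prop :=
  forall x y : X, (forall i, (pickle i < n)%N -> x i = y i) -> A x -> A y.

Definition cylinder_type : Type := X.
HB.instance Definition _ := Pointed.on cylinder_type.

Definition cylinder : set (set cylinder_type) :=
  [set A | measurable (A : set X) /\ exists n, below n A].

Lemma belowW m n (A : set X) : (m <= n)%N -> below m A -> below n A.
Proof. by move=> mn Am x y xy; apply: Am => i im; apply: xy; apply: leq_trans mn. Qed.

Lemma cylinder0 : cylinder set0.
Proof. by split; [exact: measurable0|exists 0%N]. Qed.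

Lemma cylinderU : setU_closed cylinder.
Proof.
move=> A B [mA [m Am]] [mB [n Bn]]; split; first exact: measurableU.
exists (maxn m n) => x y xy [Ax|Bx]; [left|right].
- exact: (belowW (leq_maxl m n) Am) Ax.
- exact: (belowW (leq_maxr m n) Bn) Bx.
Qed.

Lemma cylinderC : setC_closed cylinder.
Proof.
move=> A [mA [n An]]; split; first exact: measurableC.
exists n => x y xy nAx Ay; apply: nAx; apply: An Ay => i ni; exact/esym/xy.
Qed.

HB.instance Definition _ := isAlgebraOfSets.Build (prod_space_display I K)
  cylinder_type cylinder0 cylinderU cylinderC.

Definition upd (n : nat) (k : K) (x : X) : X := fun i => if pickle i == n then k else x i.

Lemma measurable_upd n : measurable_fun setT (fun z : X * K => upd n z.2 z.1).
Proof.
apply: measurable_to_prod => i; rewrite /upd; case: (pickle i == n); first exact: measurable_snd.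
exact: (measurableT_comp (measurable_coord i) measurable_fst).
Qed.

Definition integ (n : nat) (F : X -> \bar R) (x : X) : \bar R :=
  \int[kappa]_k F (upd n k x).

Fixpoint iter_integ (n m : nat) (F : X -> \bar R) : X -> \bar R :=
  if m is m'.+1 then integ n (iter_integ n.+1 m' F) else F.

Definition mnneg (F : X -> \bar R) := measurable_fun setT F /\ forall x, 0 <= F x.

Lemma mnneg_upd n F x : mnneg F -> measurable_fun setT (fun k => F (upd n k x)).
Proof.
move=> [mF _]; apply: (measurableT_comp mF).
have := @measurable_fun_pair2 _ _ _ _ _ _ _ x (measurable_upd n); exact.
Qed.

Lemma mnneg_integ n F : mnneg F -> mnneg (integ n F).
Proof.
move=> [mF F0]; split; last by move=> x; apply: integral_ge0.
have := @measurable_fun_fubini_tonelli_F _ _ X K R kappa (fun z => F (upd n z.2 z.1)).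
apply => //; exact: (measurableT_comp mF (measurable_upd n)).
Qed.

Lemma mnneg_iter n m F : mnneg F -> mnneg (iter_integ n m F).
Proof. by move=> F0; elim: m n => [//|m ih] n /=; apply/mnneg_integ/ih. Qed.

Lemma integ_const n (F : X -> \bar R) x : (forall k, F (upd n k x) = F x) ->
  integ n F x = F x.
Proof.
move=> Fx; rewrite /integ; under eq_integral do rewrite Fx.
by rewrite (integral_cst kappa measurableT) -[RHS]mule1; congr (_ * _); exact: probability_setT.
Qed.

Definition ind (A : set X) (x : X) : \bar R := (\1_A x)%:E.

Lemma mnneg_ind A : measurable A -> mnneg (ind A).
Proof.
move=> mA; split; first exact/measurable_EFinP/measurable_indic.
by move=> x; rewrite /ind lee_fin.
Qed.

Lemma ind_below n A x y : below n A -> (forall i, (pickle i < n)%N -> x i = y i) ->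
  ind A x = ind A y.
Proof.
move=> An xy; rewrite /ind !indicE; congr (_%:R%:E); congr nat_of_bool.
apply/idP/idP; rewrite !inE; first exact: An.
by apply: An => i ni; exact/esym/xy.
Qed.

Lemma upd_below n k x i : (pickle i < n)%N -> upd n k x i = x i.
Proof. by rewrite /upd; case: ltngtP. Qed.

Lemma iter_ind_const n m A x : below n A -> iter_integ n m (ind A) x = ind A x.
Proof.
elim: m n x => [//|m ih] n x An /=; have An1 : below n.+1 A by exact: belowW An.
rewrite integ_const; first exact: ih.
move=> k; rewrite !ih//; apply: (ind_below An) => i ni; exact: upd_below.
Qed.

Lemma iter_ind_stable n m p A x : below (n + m) A ->
  iter_integ n (m + p) (ind A) x = iter_integ n m (ind A) x.
Proof.
elim: m n x => [|m ih] n x; first by rewrite addn0 add0n => ?; exact: iter_ind_const.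
by move=> Am /=; apply: eq_integral => k _; rewrite ih// addSnnS.
Qed.

Definition height (A : set X) : nat := xget 0%N [set n | below n A].

Lemma heightP A : cylinder A -> below (height A) A.
Proof. by move=> [_ [n An]]; rewrite /height; case: xgetP => [//|/(_ n)]. Qed.

Definition tail_integ (n : nat) (A : set X) : X -> \bar R :=
  iter_integ n (height A - n) (ind A).

Lemma tail_integE n m A x : cylinder A -> below (n + m) A ->
  tail_integ n A x = iter_integ n m (ind A) x.
Proof.
move=> cA Am; have hA := heightP cA.
rewrite -(@iter_ind_stable n m (height A - n))//.
rewrite addnC iter_ind_stable//; apply: belowW hA.
by rewrite -leq_subLR.
Qed.

Lemma tail_integS n A : cylinder A -> tail_integ n A = integ n (tail_integ n.+1 A).
Proof.
move=> cA; apply/funext => x.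
have hA : below (n + (height A).+1) A by apply: belowW (heightP cA); rewrite addnS ltnW// ltnS leq_addl.
rewrite (tail_integE _ cA hA) /=; apply: eq_integral => k _.
by rewrite (tail_integE (m := height A))// addSn -addnS.
Qed.

(* The iterated integral of the indicator function of [A] over the finitely many
   coordinates on which it depends: it is a constant function, so that its
   value can be taken at an arbitrary point *)
Definition cylinder_content (A : set cylinder_type) : \bar R :=
  tail_integ 0 A point.

Lemma mnneg_tail n A : cylinder A -> mnneg (tail_integ n A).
Proof. by move=> [mA _]; exact/mnneg_iter/mnneg_ind. Qed.

Lemma iter_integ_ge0 n m F x : (forall x, 0 <= F x) -> 0 <= iter_integ n m F x.
Proof.
move=> F0; elim: m n x => [//|m ih] n x /=; exact: integral_ge0.
Qed.

Lemma content_ge0 A : 0 <= cylinder_content A.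
Proof. by apply: iter_integ_ge0 => x; rewrite /ind lee_fin. Qed.

Lemma content0 : cylinder_content set0 = 0.
Proof.
by rewrite /cylinder_content/tail_integ iter_ind_const// /ind indic0.
Qed.

Lemma contentT : cylinder_content setT = 1.
Proof.
by rewrite /cylinder_content/tail_integ iter_ind_const// /ind indicT.
Qed.

Lemma eq_iter_integ n m F G : F =1 G -> iter_integ n m F = iter_integ n m G.
Proof. by move=> /funext ->. Qed.

Lemma iter_integD n m F G x : mnneg F -> mnneg G ->
  iter_integ n m (F \+ G) x = iter_integ n m F x + iter_integ n m G x.
Proof.
move=> F0 G0; elim: m n x => [//|m ih] n x /=.
rewrite /integ; under eq_integral do rewrite ih.
have [? ?] := mnneg_iter n.+1 m F0; have [? ?] := mnneg_iter n.+1 m G0.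
by rewrite ge0_integralD//; exact: mnneg_upd.
Qed.

Lemma content_additive : additive2 cylinder_content.
Proof.
move=> A B cA cB AB0; rewrite /cylinder_content.
have cAB := cylinderU cA cB.
pose M := maxn (height A) (height B).
have MA : below (0 + M) A by apply: belowW (heightP cA); exact: leq_maxl.
have MB : below (0 + M) B by apply: belowW (heightP cB); exact: leq_maxr.
have MAB : below (0 + M) (A `|` B).
  by move=> x y xy [Ax|Bx]; [left; exact: MA Ax|right; exact: MB Bx].
rewrite (tail_integE _ cAB MAB) (tail_integE _ cA MA) (tail_integE _ cB MB).
rewrite -iter_integD; [|by apply: mnneg_ind; case: cA|by apply: mnneg_ind; case: cB].
congr (_ _); apply: eq_iter_integ => x.
rewrite /ind !indicE -EFinD -natrD; congr (_%:R%:E).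
rewrite in_setU; case: (boolP (x \in A)) => //= xA; case: (boolP (x \in B)) => //= xB.
by exfalso; rewrite -[False]/(set0 x) -AB0; split; rewrite -in_setE.
Qed.

Lemma content_semi_additive : measure_function.semi_additive cylinder_content.
Proof. by apply/(additive2P content0); exact: content_additive. Qed.

HB.instance Definition _ := isContent.Build (prod_space_display I K) cylinder_type R
  cylinder_content content_ge0 content_semi_additive.

Lemma tail_step n (C : set X) (D : (set X)^nat) x : cylinder C -> (forall j, cylinder (D j)) ->
  \sum_(j <oo) tail_integ n (D j) x < tail_integ n C x ->
  exists k, \sum_(j <oo) tail_integ n.+1 (D j) (upd n k x) < tail_integ n.+1 C (upd n k x).
Proof.
move=> cC cD lt; apply: contrapT => /forallNP nlt; move: lt; apply/negP; rewrite -leNgt.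
rewrite tail_integS//; under eq_eseriesr do rewrite tail_integS//.
have mt j A : cylinder A -> measurable_fun setT (fun k => tail_integ j A (upd n k x)).
  by move=> cA; apply: mnneg_upd; exact: mnneg_tail.
have t0 j A y : cylinder A -> 0 <= tail_integ j A y by move=> cA; case: (mnneg_tail j cA).
rewrite /integ -integral_nneseries//; [|by move=> j; exact: mt|by move=> j k _; exact: t0].
apply: ge0_le_integral => //.
- by move=> k _; exact: t0.
- exact: mt.
- by apply: ge0_emeasurable_sum => // [j k _ _|j _]; [exact: t0|exact: mt].
- by move=> k _; rewrite leNgt; apply/negP/nlt.
Qed.

Lemma content_sigma_subadditive : measurable_subset_sigma_subadditive cylinder_content.
Proof.
move=> C D cD cC CD; rewrite leNgt; apply/negP => lt0.
pose P n (x : X) := \sum_(j <oo) tail_integ n (D j) x < tail_integ n C x.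
have step n x : {k | P n x -> P n.+1 (upd n k x)}.
  apply: cid; have [Px|nPx] := pselect (P n x); last by exists point.
  by have [k Pk] := tail_step cC cD Px; exists k.
pose xs := fix xs n : X := if n is n'.+1 then upd n' (sval (step n' (xs n'))) (xs n') else point.
have Pxs n : P n (xs n) by elim: n => [//|n ih] /=; exact: (svalP (step n (xs n))).
pose x : X := fun i => xs (pickle i).+1 i.
have xsx n i : (pickle i < n)%N -> xs n i = x i.
  elim: n => [//|n ih]; rewrite ltnS leq_eqVlt => /orP[/eqP <-//|lt].
  by rewrite /= upd_below// ih.
have tE n A : cylinder A -> (height A <= n)%N -> tail_integ n A (xs n) = ind A x.
  move=> cA hn; rewrite /tail_integ (eqP (_ : height A - n == 0)%N)//=.
  by apply: (@ind_below n) => //; [exact: belowW (heightP cA)|exact: xsx].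
have Pn j : ind (D j) x < ind C x.
  pose n := maxn (height C) (height (D j)).
  rewrite -(tE n C cC (leq_maxl _ _)) -(tE n (D j) (cD j) (leq_maxr _ _)).
  have t0 k : 0 <= tail_integ n (D k) (xs n) by case: (mnneg_tail n (cD k)).
  apply: le_lt_trans (Pxs n); rewrite (nneseries_split 0 j.+1)//.
  rewrite add0n big_nat_recr//= addeAC; apply: leeDr.
  by apply: adde_ge0; [exact: sume_ge0|exact: nneseries_ge0].
have Cx : C x.
  by have := Pn 0%N; rewrite /ind !indicE lte_fin ltr_nat -(in_setE C x); do 2 case: (_ \in _).
have [j _ Dx] := CD _ Cx.
have := Pn j; rewrite /ind !indicE lte_fin ltr_nat (mem_set Dx).
by case: (_ \in _).
Qed.

HB.instance Definition _ := Content_SigmaSubAdditive_isMeasure.Build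
  (prod_space_display I K) R cylinder_type cylinder_content content_sigma_subadditive.

(* Caratheodory extension to the product sigma-algebra; characterized by
   [product_probability_box] and [product_probability_unique] below *)
Definition product_measure : set X -> \bar R := measure_extension cylinder_content.

Lemma measurable_cylinders : (measurable : set (set X)) = <<s cylinder >>.
Proof.
apply/seteqP; split; last first.
  by apply: smallest_sub; [exact: sigma_algebra_measurable|move=> A []].
apply: smallest_sub; first exact: smallest_sigma_algebra.
move=> A cA; apply: sub_gen_smallest; split; first exact: sub_sigma_algebra.
case: cA => i _ [B mB <-]; exists (pickle i).+1 => x y xy [_ Bx]; split => //.
by rewrite /preimage /= -xy.
Qed.

Lemma product_measure0 : product_measure set0 = 0.
Proof. exact: (measure0 (measure_extension cylinder_content)). Qed.

Lemma product_measure_ge0 A : 0 <= product_measure A.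
Proof. exact: (measure_ge0 (measure_extension cylinder_content)). Qed.

Lemma product_measure_sigma_additive : semi_sigma_additive product_measure.
Proof.
move=> F mF tF mUF.
apply: (@measure_semi_sigma_additive _ _ _ (measure_extension cylinder_content)) => //.
- by move=> i; move: (mF i); rewrite measurable_cylinders.
- by move: mUF; rewrite measurable_cylinders.
Qed.

HB.instance Definition _ := isMeasure.Build _ (prod_space I K) R product_measure
  product_measure0 product_measure_ge0 product_measure_sigma_additive.

Lemma product_measure_cylinder A : cylinder A -> product_measure A = cylinder_content A.
Proof. by move=> cA; rewrite /product_measure /measure_extension (@measurable_mu_extE _ R cylinder_type cylinder_content A). Qed.

Lemma product_measureT : product_measure setT = 1.
Proof.
rewrite product_measure_cylinder ?contentT//.
by split; [exact: measurableT|exists 0%N].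
Qed.

HB.instance Definition _ := Measure_isProbability.Build _ (prod_space I K) R
  product_measure product_measureT.

Definition product_probability : probability X R := product_measure.

Definition box (J : seq I) (B : I -> set K) : set X :=
  [set x | forall i, i \in J -> B i (x i)].

Lemma measurable_box J B : (forall i, measurable (B i)) -> measurable (box J B).
Proof.
move=> mB; elim: J => [|i J ih].
  by rewrite (_ : box _ _ = setT)//; apply/seteqP; split => // x _ i.
rewrite (_ : box _ _ = (fun x : X => x i) @^-1` B i `&` box J B).
  by apply: measurableI => //; rewrite -[_ @^-1` _]setTI; exact: measurable_coord.
apply/seteqP; split=> [x bx|x [Bx bx] j].
  by split=> [|j jJ]; apply: bx; rewrite inE ?eqxx ?jJ ?orbT.
by rewrite inE => /predU1P[->|]//; exact: bx.
Qed.

Lemma below_box J B n : (forall i, i \in J -> (pickle i < n)%N) -> below n (box J B).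
Proof. by move=> Jn x y xy bx i iJ; rewrite -xy ?Jn//; exact: bx. Qed.

Lemma integ_box n J B (A : set X) x : uniq J -> (forall i, measurable (B i)) ->
  (forall i, i \in J -> pickle i = n) -> below n A ->
  integ n (ind (A `&` box J B)) x = ind A x * \prod_(i <- J) kappa (B i).
Proof.
move=> uJ mB Jn An.
have indA k : ind A (upd n k x) = ind A x.
  by apply: (ind_below An) => i ni; exact: upd_below.
have indI k : ind (A `&` box J B) (upd n k x) = ind A x * ind (box J B) (upd n k x).
  by rewrite -(indA k) /ind indicI/= EFinM.
rewrite /integ; under eq_integral do rewrite indI.
case: J uJ Jn indI => [|i [|j J]] uJ Jn _; last 1 first.
- exfalso; have /= : i \notin j :: J by case/andP: uJ.
  rewrite inE negb_or => /andP[/negP + _]; apply; apply/eqP/(pcan_inj pickleK).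
  by rewrite !Jn// !inE eqxx ?orbT.
- rewrite big_nil mule1; under eq_integral => k _.
    rewrite (_ : ind (box [::] B) _ = 1) ?mule1; last by rewrite /ind indicE mem_set.
    over.
  rewrite (integral_cst kappa measurableT) -[RHS]mule1; congr (_ * _).
  exact: probability_setT.
- rewrite big_seq1; under eq_integral => k _.
    rewrite (_ : ind (box [:: i] B) _ = (\1_(B i) k)%:E); last first.
      rewrite /ind !indicE; congr (_%:R%:E); congr nat_of_bool.
      have upi : upd n k x i = k by rewrite /upd Jn ?inE// eqxx.
      apply/idP/idP; rewrite !inE; first by move/(_ i); rewrite upi inE eqxx; exact.
      by move=> Bk j; rewrite inE => /eqP ->; rewrite upi.
    over.
  have mi : measurable_fun setT (fun k => (\1_(B i) k)%:E : \bar R).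
    by apply/measurable_EFinP/measurable_indic.
  have i0 k : [set: K] k -> 0 <= (\1_(B i) k)%:E :> \bar R by rewrite lee_fin.
  have a0 : 0 <= ind A x by rewrite /ind lee_fin.
  by rewrite (ge0_integralZl kappa measurableT mi i0 a0) integral_indic// setIT.
Qed.

Lemma iter_integ_box n m J B (A : set X) x : uniq J -> (forall i, measurable (B i)) ->
  (forall i, i \in J -> (n <= pickle i < n + m)%N) -> measurable A -> below n A ->
  iter_integ n m (ind (A `&` box J B)) x = ind A x * \prod_(i <- J) kappa (B i).
Proof.
elim: m n J A x => [|m ih] n J A x uJ mB Jn mA An /=.
  case: J uJ Jn => [_ _|i J _ /(_ i)]; last by rewrite inE eqxx addn0 => /(_ isT); case: ltngtP.
  rewrite big_nil mule1 (_ : box _ _ = setT) ?setIT//.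
  by apply/seteqP; split => // y _ i.
pose J0 := [seq i <- J | pickle i == n]; pose J1 := [seq i <- J | pickle i != n].
have -> : A `&` box J B = (A `&` box J0 B) `&` box J1 B.
  rewrite -setIA; congr (_ `&` _); apply/seteqP; split=> [y yJ|y [y0 y1] i iJ].
    by split=> i; rewrite mem_filter => /andP[_]; exact: yJ.
  by case: (eqVneq (pickle i) n) => [e|e]; [apply: y0|apply: y1]; rewrite mem_filter iJ ?e ?eqxx.
have J0n : forall i, i \in J0 -> pickle i = n by move=> i; rewrite mem_filter => /andP[/eqP].
have E y : iter_integ n.+1 m (ind (A `&` box J0 B `&` box J1 B)) y =
    ind (A `&` box J0 B) y * \prod_(i <- J1) kappa (B i).
  apply: ih => //; first exact: filter_uniq.
  - move=> i; rewrite mem_filter => /andP[ni /Jn]; rewrite addSnnS => /andP[+ ->].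
    by rewrite leq_eqVlt eq_sym (negbTE ni) => /= ->.
  - by apply: measurableI => //; exact: measurable_box.
  - have bJ0 : below n.+1 (box J0 B) by apply: below_box => i iJ; rewrite (J0n i iJ).
    move=> u v uv [Au bu]; split; last exact: bJ0 bu.
    by apply: An Au => i ni; apply: uv; exact: leqW.
rewrite /integ; under eq_integral do rewrite E muleC.
have mI : measurable (A `&` box J0 B) by apply: measurableI => //; exact: measurable_box.
have p0 : 0 <= \prod_(i <- J1) kappa (B i) by exact: prode_ge0.
rewrite (ge0_integralZl kappa measurableT _ _ p0); last 2 first.
  by apply: mnneg_upd; exact: mnneg_ind.
  by move=> k _; rewrite /ind lee_fin.
rewrite -[integral _ _ _]/(integ n (ind (A `&` box J0 B)) x) integ_box//; last exact: filter_uniq.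
rewrite muleC -muleA; congr (_ * _).
by rewrite [RHS](bigID (fun i => pickle i == n))/= /J0 /J1 !big_filter.
Qed.

Theorem product_probability_box J B : uniq J -> (forall i, measurable (B i)) ->
  product_probability (box J B) = \prod_(i <- J) kappa (B i).
Proof.
move=> uJ mB; have [N JN] : exists N, forall i, i \in J -> (pickle i < N)%N.
  exists (\max_(i <- J) (pickle i).+1)%N => i iJ.
  by rewrite (big_rem i iJ)/= leq_maxl.
have cJ : cylinder (box J B).
  by split; [exact: measurable_box|exists N; exact: below_box].
rewrite /product_probability/= product_measure_cylinder// /cylinder_content.
rewrite (@tail_integE 0 N) ?add0n//; last exact: below_box.
rewrite -[box J B]setTI iter_integ_box//.
by rewrite /ind indicT mul1e.
Qed.

Theorem product_probability_unique (mu : {measure set X -> \bar R}) :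
  (forall J B, uniq J -> (forall i, measurable (B i)) ->
     mu (box J B) = \prod_(i <- J) kappa (B i)) ->
  forall A, measurable A -> mu A = product_probability A.
Proof.
move=> muE; pose boxes : set (set X) := [set A | exists J B,
  [/\ uniq J, forall i, measurable (B i) & A = box J B]].
apply: (@measure_unique _ R X boxes (fun=> setT) _ _ _ _ mu product_probability).
- apply/seteqP; split; apply: smallest_sub.
  + exact: smallest_sigma_algebra.
  + move=> _ [i _ [B mB <-]]; apply: sub_gen_smallest; exists [:: i], (fun=> B); split=> //.
    by rewrite setTI; apply/seteqP; split=> x; [move=> Bx j; rewrite inE => /eqP ->|apply; rewrite inE].
  + exact: sigma_algebra_measurable.
  + by move=> _ [J [B [_ mB ->]]]; exact: measurable_box.
- move=> _ _ [J [B [uJ mB ->]]] [J' [B' [uJ' mB' ->]]].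
  exists (undup (J ++ J')), (fun i => (if i \in J then B i else setT) `&` (if i \in J' then B' i else setT)).
  split; first exact: undup_uniq.
    by move=> i; apply: measurableI; case: ifP.
  apply/seteqP; split=> [x [bx bx'] i|x bx].
    by rewrite mem_undup mem_cat => _; split; case: ifP => //; [exact: bx|exact: bx'].
  split=> i iJ; have := bx i; rewrite mem_undup mem_cat iJ ?orbT => /(_ isT) []//.
- by move=> _; exists [::], (fun=> setT); split=> //; apply/seteqP; split => // x _ i.
- by apply/seteqP; split => // x _; exists 0%N.
- by move=> _ [J [B [uJ mB ->]]]; apply: etrans (muE J B uJ mB) (esym (product_probability_box uJ mB)).
- move=> _; rewrite (_ : setT = box [::] (fun=> setT)); last first.
    by apply/seteqP; split => // x _ i.
  by rewrite muE// big_nil ltry.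
Qed.

End product_probability.

(* [K] is isomorphic, as a measurable space, to a Polish (complete separable
   metric) space with its Borel sigma-algebra *)
Definition standard_borel (R : realType) d (K : measurableType d) : Prop :=
  exists (P : metricType R) (f : K -> P),
    [/\ forall F : set_system P, ProperFilter F -> cauchy F -> exists p : P, F --> p,
        exists2 D : set P, countable D & dense D,
        bijective f
      & forall A : set K, measurable A <-> <<s @open P >> (f @` A)].

Definition single_point_supported (R : realType) d (K : measurableType d)
    (kappa : probability K R) : Prop :=
  exists x : K, kappa [set x] = 1.

Section free_subgroups.
Variable G : groupType.

(* [(s, false)] stands for [s] and [(s, true)] for its inverse *)
Definition word := seq (G * bool).

Definition word_value (w : word) : G :=
  (\prod_(l <- w) if l.2 then l.1^-1 else l.1)%g.

Definition reduced (w : word) : bool :=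
  sorted (fun l m => ~~ ((l.1 == m.1) && (l.2 != m.2))) w.

(* [F] is a subgroup of [G], free on the set [S]: its elements are represented
   by a unique reduced word over [S] *)
Definition free_subgroup_on (F S : {pred G}) : Prop :=
  [/\ group_closed F, {subset S <= F}
    & forall x, x \in F -> exists! w : word,
        [/\ reduced w, all (fun l => l.1 \in S) w & word_value w = x]].

Definition contains_nonabelian_free_subgroup : Prop :=
  exists F S : {pred G}, free_subgroup_on F S /\
    exists x y, [/\ x \in F, y \in F & ~ commute x y].

End free_subgroups.

Record gsystem (R : realType) (G : groupType) := GSystem {
  gdisplay : measure_display;
  gspace :> measurableType gdisplay;
  gprob : probability gspace R;
  gact : G -> gspace -> gspace;
  gact1 : forall x, gact 1%g x = x;
  gactM : forall g h x, gact (g * h)%g x = gact g (gact h x);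
  measurable_gact : forall g, measurable_fun setT (gact g);
  gact_preserving : forall g A, measurable A -> gprob (gact g @^-1` A) = gprob A
}.
Arguments gprob {R G} X : rename.
Arguments gact {R G} X g x : rename.

Section factor_maps.
Variables (R : realType) (G : groupType).

(* [phi] is only meaningful on its domain [X']; its values elsewhere are
   irrelevant *)
Record is_factor_map (X Y : gsystem R G) (X' : set X) (phi : X -> Y) : Prop := {
  fdom_measurable : measurable X';
  fdom_full : gprob X X' = 1;
  fdom_invariant : forall g, gact X g @^-1` X' = X';
  factor_measurable : measurable_fun X' phi;
  factor_equivariant : forall g x, X' x -> phi (gact X g x) = gact Y g (phi x);
  factor_pushforward : forall B, measurable B ->
    gprob X (X' `&` phi @^-1` B) = gprob Y B
}.

Definition has_factor_map (X Y : gsystem R G) : Prop :=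
  exists (X' : set X) (phi : X -> Y), is_factor_map X' phi.

Definition weakly_isomorphic (X Y : gsystem R G) : Prop :=
  has_factor_map X Y /\ has_factor_map Y X.

End factor_maps.

Section bernoulli.
Context (R : realType) (G : countGroupType) d (K : measurableType d).
Variable kappa : probability K R.

Definition shift (g : G) (x : prod_space G K) : prod_space G K :=
  fun f => x (g^-1 * f)%g.

Lemma shift1 x : shift 1%g x = x.
Proof. by apply/funext => f; rewrite /shift invg1 mul1g. Qed.

Lemma shiftM g h x : shift (g * h)%g x = shift g (shift h x).
Proof. by apply/funext => f; rewrite /shift invgM mulgA. Qed.

Lemma measurable_shift g : measurable_fun setT (shift g).
Proof. by apply: measurable_to_prod => f; exact: measurable_coord. Qed.

Lemma shift_preserving g A : measurable A ->
  product_probability G kappa (shift g @^-1` A) = product_probability G kappa A.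
Proof.
move=> mA.
have [mu muE] : exists mu : {measure set (prod_space G K) -> \bar R},
    forall B, mu B = product_probability G kappa (shift g @^-1` B).
  unshelve eexists (pushforward (product_probability G kappa) (shift g)) => //.
  exact: measurable_shift.
rewrite -muE; apply: product_probability_unique mA => J B uJ mB; rewrite muE.
pose B' h := B (g * h)%g; pose J' := [seq (g^-1 * h)%g | h <- J].
have -> : shift g @^-1` box J B = box J' B'.
  apply/seteqP; split=> [x bx _ /mapP[h hJ ->]|x bx h hJ].
    by rewrite /B' mulVKg; exact: bx.
  by have := bx (g^-1 * h)%g; rewrite /B' mulVKg; apply; exact: map_f.
have uJ' : uniq J' by rewrite /J' map_inj_uniq//; exact: mulgI.
have mB' h : measurable (B' h) by exact: mB.
rewrite (product_probability_box kappa uJ' mB').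
by rewrite /J' big_map; apply: eq_bigr => h _; rewrite /B' mulVKg.
Qed.

Definition bernoulli_shift : gsystem R G :=
  GSystem shift1 shiftM measurable_shift shift_preserving.

End bernoulli.

(* Main.v *)
Require Import Defs.
From mathcomp Require Import all_boot all_order all_algebra.
From mathcomp Require Import all_classical all_reals all_analysis.
From mathcomp Require Import lra.

(* Fair bits generate every law on a standard Borel space: points are decoded from bit
   sequences, and bit sequences are sampled by inverse transform. So it suffices to find on
   [K^G], for every nontrivial [kappa], an equivariant family of independent fair bits indexed
   by [G * nat].

   Fix [A] with [0 < kappa A < 1], and call [g] a site of [x] when membership in [A] of
   [x g, x (g c), ..., x (g c^4)] reads 11010 or 11100. Two occurrences of these words never
   overlap at an exchanged letter, so exchanging the third and fourth letters at a site
   preserves the measure and the set of sites, and changes only the bit (third letter) of that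
   site. The bits of the sites are thus fair and independent given the sites, but sites are
   sparse. As in the Ornstein-Weiss factor map, sums of bits along the edges of a forest remain
   independent; and for free [a] and [b] and [x_m = a^(m+1) b^(m+1)], the edges
   [{g x_(2n), g x_(2n+1)}] form a forest with infinitely many edges per element of [G], so
   that each [(g, k)] can pick, equivariantly and injectively, an edge between two sites. *)

Set Implicit Arguments.
Unset Strict Implicit.
Unset Printing Implicit Defensive.

Import Order.TTheory GRing.Theory Num.Theory.
Import numFieldNormedType.Exports.

(** * A forest in a group with a free subgroup *)

Local Open Scope group_scope.

Lemma nseqSr (T : Type) n (x : T) : nseq n.+1 x = rcons (nseq n x) x.
Proof. by rewrite -addn1 nseqD cats1. Qed.

(** * Reduced words and their final powers of a letter *)

Section words.
Variable G : groupType.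
Implicit Types (w : word G) (c g : G) (z : int).

Lemma word_value_cat w1 w2 :
  word_value (w1 ++ w2) = word_value w1 * word_value w2.
Proof. exact: big_cat. Qed.

Lemma commute_word_value g w :
  (forall l, l \in w -> commute g l.1) -> commute g (word_value w).
Proof.
move=> gw; rewrite /word_value big_seq; apply: commute_prod => l /gw.
by case: l.2 => //; exact: commuteV.
Qed.

Definition power_word c z : word G := nseq `|z|%N (c, (z < 0)%R).

Lemma word_value_power c (n : nat) : word_value (power_word c n) = c ^+ n.
Proof.
rewrite /power_word /=; elim: n => [|n ih].
  by rewrite /word_value big_nil.
by rewrite [LHS]big_cons -[X in _ * X]/(word_value _) ih expgS.
Qed.

Lemma word_value_powerN c (n : nat) : word_value (power_word c (- n%:Z)) = c ^- n.
Proof.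
rewrite /power_word /=.
have -> : nseq `|(- n%:Z)%R|%N (c, (- n%:Z < 0)%R) = nseq n (c, true).
  by rewrite abszN; case: n.
elim: n => [|n ih]; first by rewrite /word_value big_nil invg1.
by rewrite [LHS]big_cons -[X in _ * X]/(word_value _) ih expgSr invgM.
Qed.

Lemma word_value_powerD c z (n : nat) :
  word_value (power_word c z) * c ^+ n = word_value (power_word c (z + n)%R).
Proof.
elim: n => [|n ih]; first by rewrite addr0 mulg1.
rewrite expgSr mulgA ih intS [(1 + _)%R]addrC addrA.
case: (z + n)%R => k; first by rewrite -PoszD addn1 !word_value_power expgSr.
rewrite NegzE; have -> : (- k.+1%:Z + 1)%R = (- k%:Z)%R.
  by rewrite intS opprD addrAC addNr add0r.
by rewrite !word_value_powerN expgS invgM mulgVK.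
Qed.

(** Letters of both signs are counted; in a reduced word the final run on [c] has one sign, so
    [trail c w] is the absolute exponent of the final power of [c] and [core c w] the length of what
    precedes it. *)
Definition trail c w := find (fun l => l.1 != c) (rev w).
Definition core c w := (size w - trail c w)%N.

Lemma trail_power c w z : trail c w = 0 -> trail c (w ++ power_word c z) = `|z|%N.
Proof.
move=> w0; rewrite /trail rev_cat find_cat /power_word rev_nseq size_nseq.
have /negbTE -> : ~~ has (fun l : G * bool => l.1 != c) (nseq `|z| (c, (z < 0)%R)).
  by rewrite has_nseq eqxx andbF.
by rewrite -/(trail c w) w0 addn0.
Qed.

Lemma core_power c w z : trail c w = 0 -> core c (w ++ power_word c z) = size w.
Proof. by move=> w0; rewrite /core trail_power// size_cat size_nseq addnK. Qed.

Lemma trail_power0 c c' w z : c != c' -> z <> 0%R -> trail c (w ++ power_word c' z) = 0.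
Proof.
move=> cc'; rewrite /power_word /trail rev_cat rev_nseq => z0.
have : (0 < `|z|)%N by rewrite absz_gt0; apply/eqP.
by case: `|z|%N => // n _ /=; rewrite eq_sym cc'.
Qed.

Lemma reduced_rcons w l : reduced (rcons w l) =
  reduced w && (if rev w is m :: _ then ~~ ((m.1 == l.1) && (m.2 != l.2)) else true).
Proof.
case/lastP: w => [|w m]; first by [].
rewrite rev_rcons /reduced; case: w => [|x w] /=; first by rewrite andbT.
by rewrite rcons_path last_rcons.
Qed.

Lemma reduced_power c w z : trail c w = 0 -> reduced w -> reduced (w ++ power_word c z).
Proof.
rewrite /power_word => w0 rw; elim: `|z|%N => [|n ih]; first by rewrite cats0.
rewrite nseqSr -cats1 catA cats1 reduced_rcons ih/=.
case: n {ih} => [|n].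
  rewrite cats0; move: w0; rewrite /trail; case: (rev w) => //= m s.
  by case: eqP.
by rewrite rev_cat rev_nseq /= !eqxx.
Qed.

(** Induction on the last letter: another letter than [c] leaves an empty final power, and a letter
    [c] or its inverse lengthens the power that is already there. *)
Lemma reduced_decomp c w : reduced w ->
  exists w' z, [/\ reduced w', trail c w' = 0 & w = w' ++ power_word c z].
Proof.
elim/last_ind: w => [_|w l ih]; first by exists [::], 0%R.
rewrite reduced_rcons => /andP[rw wl].
have [lc|lc] := eqVneq l.1 c; last first.
  exists (rcons w l), 0%R; rewrite cats0; split=> //.
    by rewrite reduced_rcons rw.
  by rewrite /trail rev_rcons /= lc.
have [w' [z [rw' w'0 wE]]] := ih rw; exists w'.
case: l lc wl => _ s /= -> wl.
have [z0|z0] := eqVneq z 0%R.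
  exists (if s then -1 else 1)%R; split=> //.
  by rewrite wE z0 cats0 -cats1; case: s {wl}.
(* The letter before the last one is also on [c]; reducedness forces the two signs to agree. *)
have sz : s = (z < 0)%R.
  move: wl; rewrite wE rev_cat rev_nseq.
  have : (0 < `|z|)%N by rewrite absz_gt0.
  by case: `|z|%N => // n _ /=; rewrite eqxx /= negbK => /eqP.
subst s; exists (if (z < 0)%R then z - 1 else z + 1)%R; split=> //.
rewrite wE -cats1 -catA; congr (_ ++ _); rewrite /power_word cats1 -nseqSr.
have posz k : (k%:Z < 0)%R = false by [].
have negz k : (- k.+1%:Z < 0)%R = true by [].
case: z z0 {wE wl} => n n0.
  by rewrite posz -PoszD addn1 posz.
by rewrite NegzE negz -opprD -PoszD addn1 negz.
Qed.

End words.

(** * Normal forms in the cosets of a free subgroup *)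

Section free_group.
Variables (G : groupType) (F S : {pred G}).
Hypothesis FS : free_subgroup_on F S.
Implicit Types (g f : G) (w : word G).

Let over w := all (fun l => l.1 \in S) w.

Let over_cat w1 w2 : over (w1 ++ w2) = over w1 && over w2.
Proof. exact: all_cat. Qed.

Let over_power c z : c \in S -> over (power_word c z).
Proof. by move=> cS; rewrite /over all_nseq cS orbT. Qed.

Lemma free_subgroupM : {in F &, forall x y, x * y \in F}.
Proof. by have [/group_closedM FM _ _] := FS; exact: FM. Qed.

Lemma free_subgroupV : {in F, forall x, x^-1 \in F}.
Proof. by have [/group_closedV FV _ _] := FS; exact: FV. Qed.

Lemma free_subgroup1 : 1 \in F.
Proof. by have [[? _] _ _] := FS. Qed.

Lemma word_value_mem w : over w -> word_value w \in F.
Proof.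
have [_ SF _] := FS; elim: w => [_|l w ih /= /andP[lS /ih wF]].
  by rewrite /word_value big_nil free_subgroup1.
rewrite /word_value big_cons; apply: free_subgroupM => //.
by case: l.2; [apply: free_subgroupV|]; exact: SF.
Qed.

Definition reduced_word f : word G :=
  xget [::] [set w : word G | [/\ reduced w, over w & word_value w = f]]%classic.

Lemma reduced_wordP f : f \in F ->
  [/\ reduced (reduced_word f), over (reduced_word f) & word_value (reduced_word f) = f].
Proof.
have [_ _ /(_ f) uniq] := FS => /uniq[w [wP _]].
by rewrite /reduced_word; case: xgetP => [//|/(_ w)].
Qed.

Lemma reduced_wordE w : reduced w -> over w -> reduced_word (word_value w) = w.
Proof.
move=> rw ow; have wF := word_value_mem ow.
have [_ _ /(_ _ wF)[u [_ uu]]] := FS.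
by rewrite -(uu _ (reduced_wordP wF)); exact: uu.
Qed.

(** A chosen element of the coset [g F]. The set from which it is chosen depends on the coset only,
    so the choice does too; reduced words over [S] then locate every element of [G] inside its
    coset. *)
Definition coset_repr g : G := xget 1 [set h : G | h^-1 * g \in F]%classic.

Lemma coset_repr_mem g : (coset_repr g)^-1 * g \in F.
Proof.
rewrite /coset_repr; case: xgetP => [//|/(_ g)/= []].
by rewrite mulVg free_subgroup1.
Qed.

Lemma coset_reprM g f : f \in F -> coset_repr (g * f) = coset_repr g.
Proof.
move=> fF; congr xget; apply/funext => h /=; apply/propext; rewrite mulgA.
split=> hF; last exact: free_subgroupM.
by rewrite -[_ * g](mulgK f); apply: free_subgroupM => //; exact: free_subgroupV.
Qed.

Definition coset_word g := reduced_word ((coset_repr g)^-1 * g).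

Lemma coset_wordM g f : f \in F ->
  coset_word (g * f) = reduced_word (word_value (coset_word g) * f).
Proof.
move=> fF; rewrite /coset_word coset_reprM// mulgA.
by have [_ _ ->] := reduced_wordP (coset_repr_mem g).
Qed.

Variables a b : G.
Hypotheses (aS : a \in S) (bS : b \in S) (ab : a != b).

Definition branch (m : nat) := a ^+ m.+1 * b ^+ m.+1.

Lemma branch_mem m : branch m \in F.
Proof.
rewrite /branch -!word_value_power -word_value_cat; apply: word_value_mem.
by rewrite over_cat !over_power.
Qed.

(** The normal form is [a^(m+1) b^(m+1+i)]: its core gives [m] and its trail then gives [i]. This
    keeps the windows read at different branches apart. *)
Lemma branch_inj : injective (fun p : nat * nat => branch p.1 * b ^+ p.2).
Proof.
pose u (p : nat * nat) := power_word a p.1.+1 ++ power_word b (p.1.+1 + p.2)%N.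
have uE p : branch p.1 * b ^+ p.2 = word_value (u p).
  by rewrite /branch /u word_value_cat !word_value_power expgnDr mulgA.
have t0 p : trail b (power_word a p.+1) = 0.
  by apply: (@trail_power0 _ b a [::] p.+1%:Z) => //; rewrite eq_sym.
have ru p : reduced (u p) /\ over (u p).
  split; last by rewrite over_cat !over_power.
  apply: reduced_power; first exact: t0.
  exact: (@reduced_power _ a [::] p.1.+1%:Z erefl erefl).
move=> [m i] [n j]; rewrite !uE => /(congr1 reduced_word).
rewrite !reduced_wordE; try exact: (ru _).1; try exact: (ru _).2.
move=> e; have := congr1 (trail b) e; have := congr1 (core b) e.
rewrite !core_power ?trail_power//= !size_nseq => -[->].
by rewrite !addSn => -[] /addnI ->.
Qed.

(* [g a^(m+1)] is the end of a reduced word in [a] unless its powers of [a] cancel,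
   which happens for at most one [m]; appending [b^(m+1)] then cancels nothing. *)
Lemma branch_tree g : exists r : nat,
  (forall m, (r < core b (coset_word (g * branch m)))%N ->
     trail b (coset_word (g * branch m)) = m.+1) /\
  (forall m n, m != n -> (r < core b (coset_word (g * branch m)))%N \/
     (r < core b (coset_word (g * branch n)))%N).
Proof.
have [rw ow _] := reduced_wordP (coset_repr_mem g).
rewrite -/(coset_word g) in rw ow.
have [w [z [rw' w'0 wE]]] := reduced_decomp a rw.
have ow' : over w by move: ow; rewrite wE over_cat => /andP[].
have noncancel m : (z + m.+1%:Z)%R <> 0%R -> exists2 P, (size w < size P)%N &
    trail b P = 0 /\ coset_word (g * branch m) = P ++ power_word b m.+1.
  move=> zm; exists (w ++ power_word a (z + m.+1%:Z)).
    by rewrite size_cat size_nseq -addn1 leq_add2l absz_gt0; apply/eqP.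
  have P0 : trail b (w ++ power_word a (z + m.+1%:Z)) = 0.
    by apply: trail_power0 => //; rewrite eq_sym.
  split=> //; rewrite coset_wordM ?branch_mem// wE -[RHS]reduced_wordE.
  - by rewrite !word_value_cat -word_value_powerD word_value_power !mulgA.
  - by apply: reduced_power => //; exact: reduced_power.
  - by rewrite !over_cat ow' !over_power.
(* Once the power of [a] is gone, [b^(m+1)] merges with the final power of [b] in [w], and what
   precedes that power lies inside [w]. *)
have cancel m : (z + m.+1%:Z)%R = 0%R ->
    (core b (coset_word (g * branch m)) <= size w)%N.
  move=> zm; have [v [y [rv v0 vE]]] := reduced_decomp b rw'.
  have ov : over v by move: ow'; rewrite vE over_cat => /andP[].
  suff -> : coset_word (g * branch m) = v ++ power_word b (y + m.+1%:Z).
    by rewrite core_power// vE size_cat leq_addr.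
  rewrite coset_wordM ?branch_mem// wE -[RHS]reduced_wordE.
  - rewrite word_value_cat -mulgA [word_value (power_word a z) * _]mulgA.
    rewrite word_value_powerD zm (word_value_power a 0) mul1g vE.
    by rewrite !word_value_cat -word_value_powerD mulgA.
  - exact: reduced_power.
  - by rewrite !over_cat ov !over_power.
(* The threshold [size w] tells the two cases apart: the core is longer than [w] when a power of [a]
   survives and not longer when it cancels. *)
exists (size w); split=> [m wm|m n mn].
  have [/cancel|/eqP/noncancel[P _ [P0 ->]]] := eqVneq (z + m.+1%:Z)%R 0%R.
    by rewrite leqNgt wm.
  by rewrite trail_power.
have [zm|/eqP/noncancel[P wP [P0 ->]]] := eqVneq (z + m.+1%:Z)%R 0%R; last first.
  by left; rewrite core_power.
right; have [zn|/eqP/noncancel[P wP [P0 ->]]] := eqVneq (z + n.+1%:Z)%R 0%R; last first.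
  by rewrite core_power.
case/eqP: mn.
by have := etrans zm (esym zn) => /addrI[].
Qed.

End free_group.

(** Join each [g] to all [g * x m]. All but at most one of these neighbours are deeper than a
    threshold depending on [g], and the label of such a neighbour gives back [m], hence also [g]. *)
Lemma free_forest (G : groupType) : contains_nonabelian_free_subgroup G ->
  exists (c : G) (x : nat -> G) (depth label : G -> nat),
    injective (fun p : nat * nat => x p.1 * c ^+ p.2) /\
    forall g : G, exists r : nat,
      (forall m, (r < depth (g * x m)%g)%N -> label (g * x m) = m) /\
      (forall m n, m != n -> (r < depth (g * x m)%g)%N \/ (r < depth (g * x n)%g)%N).
Proof.
move=> [F [S [FS [f [h [fF hF fh]]]]]].
(* Without two distinct elements in [S], all words would use at most one letter and [F] would be
   commutative. *)
have [a [b [aS bS ab]]] : exists a b, [/\ a \in S, b \in S & a != b].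
  apply: contrapT => nab; apply: fh; have [_ _ FSu] := FS.
  have [w [[_ wS <-] _]] := FSu f fF; have [u [[_ uS <-] _]] := FSu h hF.
  have eqS s t : s \in S -> t \in S -> s = t.
    by move=> sS tS; apply: contrapT => /eqP st; apply: nab; exists s, t.
  apply: commute_word_value => l lu; apply/commute_sym/commute_word_value => k kw.
  by rewrite (eqS _ _ (allP uS _ lu) (allP wS _ kw)); exact: commute_refl.
exists b, (branch a b), (fun g => core b (coset_word F S g)).
(* The final power of [b] in a deep [g * branch m] is [b^(m+1)], hence the predecessor. *)
exists (fun g => (trail b (coset_word F S g)).-1); split; first exact: (branch_inj FS aS bS ab).
move=> g; have [r [rt rm]] := branch_tree FS aS bS ab g.
by exists r; split=> // m /rt ->.
Qed.

(* The leaf is an endpoint of maximal depth: were it the shallow endpoint of some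
   edge, the other endpoint of that edge would be deeper. *)
Lemma free_forest_leaf (G : groupType) : contains_nonabelian_free_subgroup G ->
  exists (c : G) (v : nat * bool -> G),
    injective (fun p : nat * bool * nat => v p.1 * c ^+ p.2) /\
    forall s : seq (G * nat), s <> [::] -> exists e b, e \in s /\
      forall e' b', e' \in s -> e'.1 * v (e'.2, b') = e.1 * v (e.2, b) ->
        e' = e /\ b' = b.
Proof.
move=> /free_forest[c [x [depth [label [xc tree]]]]].
pose idx (p : nat * bool) := (p.2 + p.1.*2)%N.
have idx_inj : injective idx.
  move=> [m i] [n j]; rewrite /idx /= => e.
  have : odd (i + m.*2) = odd (j + n.*2) by rewrite e.
  rewrite !oddD !odd_double !addbF !oddb => ij; subst j; move/addnI: e => /double_inj -> //.
exists c, (x \o idx); split.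
  by move=> [p i] [q j] /(@xc (idx p, i) (idx q, j)) [/idx_inj -> ->].
move=> s s0; pose V := [seq (e, b) | e <- s, b <- [:: false; true]].
have mV e b : e \in s -> (e, b) \in V.
  by move=> es; apply: (allpairs_f pair) => //; case: b.
pose D (p : (G * nat) * bool) := depth (p.1.1 * x (idx (p.1.2, p.2))).
have [p [pV pmax]] : exists p, p \in V /\ forall q, q \in V -> (D q <= D p)%N.
  have [e es] : exists e, e \in s by case: (s) s0 => // e ? _; exists e; exact: mem_head.
  have : exists p, p \in V by exists (e, false); exact: mV.
  elim: (V) => [[]//|q W ih _].
  case: W ih => [_|q' W ih]; first by exists q; split=> [|y]; rewrite inE// => /eqP ->.
  have [|p [pV pm]] := ih; first by exists q'; exact: mem_head.
  have [qp|pq] := leqP (D q) (D p).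
    by exists p; split=> [|y]; rewrite inE ?pV ?orbT// => /predU1P[->//|/pm].
  exists q; split=> [|y]; first exact: mem_head.
  by rewrite inE => /predU1P[->//|/pm/leq_trans]; apply; exact: ltnW.
have deepest e b : e \in s -> (D p <= D (e, b))%N ->
    label (e.1 * x (idx (e.2, b))) = idx (e.2, b).
  move=> es pe; have [r [rl rm]] := tree e.1; apply: rl.
  have /rm[//|lt] : idx (e.2, b) != idx (e.2, ~~ b).
    by apply/eqP => /idx_inj[]; case: (b).
  by apply: leq_trans lt (leq_trans (pmax _ (mV e (~~ b) es)) pe).
have ps : p.1 \in s by have /allpairsP[[e b] /= [es _ ->]] := pV.
exists p.1, p.2; split=> // e' b' e's.
rewrite -[_ = _]/(e'.1 * x (idx (e'.2, b')) = p.1.1 * x (idx (p.1.2, p.2))) => E.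
(* Two descriptions of the same point carry the same label, which fixes the index of the edge and
   the endpoint; cancelling [x] then fixes the base point. *)
have := deepest _ b' e's; rewrite /D /= E => /(_ (leqnn _)).
have := deepest _ p.2 ps; rewrite /D /= => /(_ (leqnn _)) -> /idx_inj[e2 eb].
split=> //; move: E; rewrite -eb -e2 => /mulIg.
by case: e' {e's} e2 => ? ? /=; case: (p.1) => ? ? /= -> ->.
Qed.

Local Close Scope group_scope.
Local Open Scope classical_set_scope.
Local Open Scope ring_scope.
Local Open Scope ereal_scope.

(** * Product measures *)

Section product_maps.
Context (R : realType) (I : countType).

(** Uniqueness of the product measure, applied to the pushforward: a law on a product space is
    identified by its values on boxes. *)
Lemma product_probability_map d (K : measurableType d) (kappa : probability K R)
    d' (T : measurableType d') (mu : probability T R) (f : T -> prod_space I K) :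
  measurable_fun setT f ->
  (forall J B, uniq J -> (forall i, measurable (B i)) ->
     mu (f @^-1` box J B) = \prod_(i <- J) kappa (B i)) ->
  forall A, measurable A -> mu (f @^-1` A) = product_probability I kappa A.
Proof.
move=> mf muE A mA.
have [nu nuE] : exists nu : {measure set (prod_space I K) -> \bar R},
    forall B, nu B = mu (f @^-1` B).
  by unshelve eexists (pushforward mu f).
by rewrite -nuE; apply: product_probability_unique mA => J B uJ mB; rewrite nuE muE.
Qed.

(** The case of interest is an [s] that exchanges two indices: this makes flipping a site
    measure-preserving. *)
Lemma product_probability_reindex d (K : measurableType d) (kappa : probability K R)
    (s : I -> I) (A : set (prod_space I K)) : involutive s -> measurable A ->
  product_probability I kappa ((fun x i => x (s i)) @^-1` A) = product_probability I kappa A.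
Proof.
move=> ss; move: A; apply: product_probability_map => [|J B uJ mB].
  by apply: measurable_to_prod => i; exact: measurable_coord.
have -> : (fun (x : prod_space I K) i => x (s i)) @^-1` box J B = box (map s J) (B \o s).
  apply/seteqP; split=> [x bx _ /mapP[i iJ ->]|x bx i iJ] /=.
    by rewrite ss; exact: bx.
  by have /= := bx _ (map_f s iJ); rewrite ss.
rewrite product_probability_box ?map_inj_uniq//; last by move=> i; exact: mB.
  by rewrite big_map; apply: eq_bigr => i _ /=; rewrite ss.
exact: inv_inj.
Qed.

Lemma measurable_comp_prod d d' (K : measurableType d) (L : measurableType d') (f : K -> L) :
  measurable_fun setT f ->
  measurable_fun setT (fun x : prod_space I K => (f \o x : prod_space I L)).
Proof.
move=> mf; apply: measurable_to_prod => i.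
exact: (measurableT_comp mf (measurable_coord i)).
Qed.

Lemma product_probability_comp d d' (K : measurableType d) (L : measurableType d')
    (kappa : probability K R) (lambda : probability L R) (f : K -> L) :
  measurable_fun setT f ->
  (forall B, measurable B -> kappa (f @^-1` B) = lambda B) ->
  forall A : set (prod_space I L), measurable A ->
  product_probability I kappa ((fun x => f \o x) @^-1` A) = product_probability I lambda A.
Proof.
move=> mf fE; apply: product_probability_map; first exact: measurable_comp_prod.
move=> J B uJ mB.
have mfB i : measurable (f @^-1` B i) by rewrite -[_ @^-1` _]setTI; exact: mf.
rewrite -[_ @^-1` _]/(box J (fun i => f @^-1` B i)) product_probability_box//.
by apply: eq_bigr => i _; exact: fE.
Qed.

End product_maps.

Lemma measurable_prod_curry (I J : Type) d (K : measurableType d) : measurable_fun setT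
  (fun (y : prod_space (I * J) K) => (fun i j => y (i, j)) : prod_space I (prod_space J K)).
Proof. by do 2 apply: measurable_to_prod => ?; exact: measurable_coord. Qed.

(** A box over [I * J] is a box over [I] whose sides are themselves boxes, one for each row; the
    product of all factors is then grouped by rows. *)
Lemma product_probability_uncurry (R : realType) (I J : countType) d (K : measurableType d)
    (kappa : probability K R) (A : set (prod_space (I * J) K)) : measurable A ->
  product_probability I (product_probability J kappa) ((fun z p => z p.1 p.2) @^-1` A) =
  product_probability (I * J)%type kappa A.
Proof.
move: A; apply: product_probability_map => [|s B us mB].
  apply: measurable_to_prod => p.
  exact: (measurableT_comp (measurable_coord p.2) (measurable_coord p.1)).
pose row i := [seq p.2 | p <- s & p.1 == i].
have urow i : uniq (row i).
  rewrite map_inj_in_uniq ?filter_uniq// => p q; rewrite !mem_filter.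
  move=> /andP[/eqP pi _] /andP[/eqP qi _] pq.
  by rewrite (surjective_pairing p) pi pq -qi -surjective_pairing.
have -> : (fun (z : prod_space I (prod_space J K)) p => z p.1 p.2) @^-1` box s B =
    box (undup [seq p.1 | p <- s]) (fun i => box (row i) (fun j => B (i, j))).
  apply/seteqP; split=> [z bz i _ j /mapP[p]|z bz p ps].
    rewrite mem_filter => /andP[/eqP <- ps] ->; rewrite -surjective_pairing.
    exact: bz.
  rewrite [p]surjective_pairing; apply: bz; first by rewrite mem_undup map_f.
  by apply/mapP; exists p; rewrite // mem_filter eqxx.
rewrite product_probability_box; [|exact: undup_uniq|]; last first.
  by move=> i; apply: measurable_box => j; exact: mB.
have rowE i : product_probability J kappa (box (row i) (fun j => B (i, j))) =
    \prod_(p <- s | p.1 == i) kappa (B p).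
  rewrite product_probability_box// /row big_map big_filter; apply: eq_bigr => p /eqP <-.
  by rewrite -surjective_pairing.
under eq_bigr do rewrite rowE.
rewrite (exchange_big_dep predT)//= big_seq [RHS]big_seq; apply: eq_bigr => p ps.
under eq_bigl do rewrite eq_sym.
rewrite -big_filter filter_pred1_uniq ?undup_uniq ?big_seq1//.
by rewrite mem_undup map_f.
Qed.

(** * Independent events on disjoint sets of coordinates *)

Section disjoint_boxes.
Context (R : realType) (I : countType) d (K : measurableType d) (kappa : probability K R).
Variables (J : nat -> seq I) (B : nat -> I -> set K) (q : R).
Hypotheses (uJ : forall n, uniq (J n)) (mB : forall n i, measurable (B n i)).
Hypothesis dJ : forall m n i, i \in J m -> i \in J n -> m = n.
Hypothesis Jq : forall n, product_probability I kappa (box (J n) (B n)) = q%:E.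

Let mu := product_probability I kappa.
Let avoid n : set (prod_space I K) :=
  [set x | forall m, (m < n)%N -> ~ box (J m) (B m) x].

Let avoidS n : avoid n.+1 = avoid n `&` ~` box (J n) (B n).
Proof.
apply/seteqP; split=> [x xn|x [xn xJ] m].
  by split=> [m mn|]; apply: xn => //; exact: leqW.
by rewrite ltnS leq_eqVlt => /predU1P[-> //|]; exact: xn.
Qed.

Let measurable_avoid n : measurable (avoid n).
Proof.
elim: n => [|n ih]; first by rewrite (_ : avoid 0 = setT)//; apply/seteqP; split.
rewrite avoidS; apply: measurableI => //; apply: measurableC.
exact: measurable_box.
Qed.

(** The extra box on fresh coordinates makes the induction work: avoiding one more box subtracts the
    same kind of event with [J n] added to [J'], and the induction hypothesis applies to both
    terms. *)
Let avoid_box n J' B' : uniq J' -> (forall i, measurable (B' i)) ->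
  (forall m i, (m < n)%N -> i \in J m -> i \notin J') ->
  mu (avoid n `&` box J' B') = ((1 - q) ^+ n)%:E * mu (box J' B').
Proof.
elim: n J' B' => [|n ih] J' B' uJ' mB' JJ'.
  rewrite expr0 mul1e (_ : avoid 0 = setT) ?setTI//.
  by apply/seteqP; split.
pose B1 i := if i \in J n then B n i else B' i.
have mB1 i : measurable (B1 i) by rewrite /B1; case: ifP.
have uJ1 : uniq (J n ++ J').
  rewrite cat_uniq uJ uJ' andbT; apply/hasPn => i iJ'; apply/negP => iJ.
  by have := JJ' n i (ltnSn n) iJ; rewrite iJ'.
have split1 : box (J n ++ J') B1 = box (J n) (B n) `&` box J' B'.
  apply/seteqP; split=> [x bx|x [bx bx'] i].
    split=> i iJ; have := bx i; rewrite mem_cat iJ ?orbT /B1 => /(_ isT).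
      by rewrite iJ.
    by case: ifP => // iJn; have := JJ' n i (ltnSn n) iJn; rewrite iJ.
  rewrite mem_cat /B1; case: ifP => [iJ _|_ /= iJ']; [exact: bx|exact: bx'].
have mubox : mu (box (J n ++ J') B1) = q%:E * mu (box J' B').
  rewrite -(Jq n) /mu !product_probability_box// big_cat/=; congr (_ * _).
    by rewrite !big_seq; apply: eq_bigr => i iJ; rewrite /B1 iJ.
  rewrite !big_seq; apply: eq_bigr => i iJ'; rewrite /B1; case: ifP => // iJ.
  by have := JJ' n i (ltnSn n) iJ; rewrite iJ'.
have -> : avoid n.+1 `&` box J' B' =
    (avoid n `&` box J' B') `\` (avoid n `&` box (J n ++ J') B1).
  rewrite avoidS split1; apply/seteqP; split=> x.
    by move=> [[xn xJ] xJ']; split => // -[_ []].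
  by move=> [[xn xJ'] xJ]; split => //; split => // xJn; apply: xJ.
have mI J2 B2 : (forall i, measurable (B2 i)) -> measurable (avoid n `&` box J2 B2).
  by move=> mB2; apply: measurableI => //; exact: measurable_box.
have muI : mu (avoid n `&` box J' B') < +oo.
  exact: le_lt_trans (probability_le1 _ (mI _ _ mB')) (ltry 1).
rewrite measureD//; [|exact: mI|exact: mI].
have sub : avoid n `&` box (J n ++ J') B1 `<=` avoid n `&` box J' B'.
  by rewrite split1 => x [xn [_ xJ']].
have JJ1 m i : (m < n)%N -> i \in J m -> i \notin J n ++ J'.
  move=> mn iJ; rewrite mem_cat negb_or; apply/andP; split.
    by apply/negP => /(dJ iJ) mE; rewrite mE ltnn in mn.
  by apply: JJ' iJ; exact: leqW.
have JJ0 m i : (m < n)%N -> i \in J m -> i \notin J' by move=> mn; apply: JJ'; exact: leqW.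
rewrite (setIidr sub) -[X in X - _]/(mu _) -[X in _ - X]/(mu _).
rewrite (ih _ _ uJ1 mB1 JJ1) (ih _ _ uJ' mB' JJ0) mubox.
have /fineK <- : mu (box J' B') \is a fin_num by apply: fin_num_measure; exact: measurable_box.
by rewrite -!EFinM -EFinB exprSr mulrA -mulrBl mulrBr mulr1.
Qed.

(** A form of the second Borel-Cantelli lemma: the probability is at most [(1 - q)^n] for every
    [n]. *)
Lemma avoid_boxes_null : (0 < q)%R ->
  product_probability I kappa [set x | forall n, ~ box (J n) (B n) x] = 0.
Proof.
move=> q0; set A := [set x | _].
have mA : measurable A.
  rewrite (_ : A = \bigcap_n avoid n).
    exact: bigcapT_measurable.
  apply/seteqP; split=> [x xA n _ m _|x xA n]; first exact: xA.
  exact: (xA n.+1 Logic.I n (ltnSn n)).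
have q1 : (q <= 1)%R.
  by rewrite -lee_fin -(Jq 0%N) probability_le1//; exact: measurable_box.
have le n : mu A <= ((1 - q) ^+ n)%:E.
  apply: (@le_trans _ _ (mu (avoid n))).
    by apply: le_measure; rewrite ?inE// => x xA m _; exact: xA.
  have := @avoid_box n [::] (fun=> setT) erefl (fun=> measurableT) (fun _ _ _ _ => isT).
  have -> : box [::] (fun=> [set: K]) = [set: prod_space I K] by apply/seteqP; split.
  by rewrite setIT probability_setT mule1 => ->.
apply/eqP; rewrite eq_le measure_ge0 andbT.
have /fineK <- : mu A \is a fin_num by exact: fin_num_measure.
rewrite lee_fin; have cv := @cvg_expr R (1 - q)%R.
have lt1 : (`|1 - q| < 1)%R by rewrite ger0_norm ?subr_ge0// ltrBlDr ltrDl.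
have <- : limn (fun n => (1 - q) ^+ n)%R = 0%R by apply: cvg_lim => //; exact: cv.
apply: limr_ge; first exact: cvgP (cv lt1).
apply: nearW => n; rewrite -lee_fin fineK//.
exact: fin_num_measure.
Qed.

End disjoint_boxes.

(** * Fair bits *)

Section measurable_predicates.
Context d (T : measurableType d).
Implicit Types p q : T -> bool.

Lemma measurable_predN p : measurable [set x | p x] -> measurable [set x | ~~ p x].
Proof.
move=> mp; rewrite (_ : [set x | ~~ p x] = ~` [set x | p x]); first exact: measurableC.
by apply/seteqP; split=> x /negP.
Qed.

Lemma measurable_predI p q : measurable [set x | p x] -> measurable [set x | q x] ->
  measurable [set x | p x && q x].
Proof.
move=> mp mq; rewrite (_ : [set x | p x && q x] = [set x | p x] `&` [set x | q x]).
  exact: measurableI.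
by apply/seteqP; split=> x /andP.
Qed.

Lemma measurable_predX p q : measurable [set x | p x] -> measurable [set x | q x] ->
  measurable [set x | p x (+) q x].
Proof.
move=> mp mq; rewrite (_ : [set x | p x (+) q x] =
    [set x | p x && ~~ q x] `|` [set x | ~~ p x && q x]).
  by apply: measurableU; apply: measurable_predI => //; exact: measurable_predN.
by apply/seteqP; split=> x /=; case: (p x); case: (q x) => //; (try by left); (try by right); case.
Qed.

Lemma measurable_pred_all (I : Type) (s : seq I) (p : I -> T -> bool) :
  (forall i, measurable [set x | p i x]) -> measurable [set x | all (p^~ x) s].
Proof.
move=> mp; elim: s => [|i s ih] /=; last exact: measurable_predI.
by rewrite (_ : [set x | _] = setT)//; apply/seteqP; split.
Qed.

Lemma measurable_pred_exists (p : nat -> T -> bool) :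
  (forall n, measurable [set x | p n x]) -> measurable [set x | `[< exists n, p n x >]].
Proof.
move=> mp; rewrite (_ : [set x | _] = \bigcup_n [set x | p n x]).
  exact: bigcupT_measurable.
by apply/seteqP; split=> [x /asboolP[n]|x [n _ pn]]; [exists n|apply/asboolP; exists n].
Qed.

Lemma measurable_pred_fun p : measurable [set x | p x] -> measurable_fun setT p.
Proof.
by move=> mp; apply: (measurable_fun_bool true); rewrite setTI (_ : _ @^-1` _ = [set x | p x]).
Qed.

End measurable_predicates.

(** * Sites and the exchange of two letters *)

Section sites.
Context (G : countGroupType) d (K : measurableType d) (A : set K) (c : G).
Notation X := (prod_space G K).
Implicit Types (x : X) (u g : G).
Local Open Scope group_scope.

Definition spin x g : bool := x g \in A.

Definition site x g := [&& spin x g, spin x (g * c), spin x (g * c ^+ 2) != spin x (g * c ^+ 3)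
  & ~~ spin x (g * c ^+ 4)].

Definition bit x g := spin x (g * c ^+ 2).

Definition swap u g := if g == u * c ^+ 2 then u * c ^+ 3 else
  if g == u * c ^+ 3 then u * c ^+ 2 else g.

Definition flip u x : X := fun g => x (swap u g).

Lemma swapK u : involutive (swap u).
Proof.
move=> g; rewrite /swap; have [->|g2] := eqVneq g (u * c ^+ 2).
  by rewrite eqxx; case: eqVneq => // ->.
have [->|g3] := eqVneq g (u * c ^+ 3); first by rewrite eqxx.
by rewrite (negbTE g2) (negbTE g3).
Qed.

Lemma flipK u : involutive (flip u).
Proof. by move=> x; apply/funext => g; rewrite /flip swapK. Qed.

(** Places 0 to 4 of a site read 1, 1, two different letters, 0. A second site one place on needs 1
    at place 2, hence 0 at place 3, yet different letters at places 3 and 4; two places on, it needs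
    1 at both places 2 and 3; three places on, 1 at place 4. *)
Lemma site_overlap x u i : site x u -> (0 < i < 4)%N -> site x (u * c ^+ i) -> False.
Proof.
rewrite /site -!mulgA -!expgnDr -!expgSr.
move=> /and4P[_ s1 s23 s4].
case: i => [//|[|[|[|//]]]] _ /and4P[]; rewrite ?expg1 => t1 t2.
- rewrite -[(1 + 2)%N]/3%N -[(1 + 3)%N]/4%N (negbTE s4) => t3.
  by move: s23 t3; rewrite t2; case: (spin x _).
- by move: s23; rewrite t1 t2.
- by move: s4; rewrite t2.
Qed.

(** If the positions agreed, one of [g] and [u] would be the other times [c] to a power between 1
    and 3, against [site_overlap]. So the exchange at [u], which concerns [j = 2] and [j = 3],
    touches no letter of another site. *)
Lemma site_disjoint x u g i j : site x u -> site x g -> g != u ->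
  (i < 5)%N -> (1 < j < 4)%N -> g * c ^+ i != u * c ^+ j.
Proof.
move=> su sg gu i5 /andP[j1 j4]; apply/eqP => e; have [ji|ij] := leqP i j.
  have gE : g = u * c ^+ (j - i).
    by apply: (mulIg (c ^+ i)); rewrite e -mulgA -expgnDr subnK.
  apply: (@site_overlap x u (j - i) su); last by rewrite -gE.
  rewrite (leq_ltn_trans (leq_subr _ _) j4) andbT subn_gt0 ltn_neqAle ji andbT.
  by apply/eqP => ijE; rewrite gE ijE subnn mulg1 eqxx in gu.
have uE : u = g * c ^+ (i - j).
  by apply: (mulIg (c ^+ j)); rewrite -e -mulgA -expgnDr subnK// ltnW.
apply: (@site_overlap x g (i - j) sg); last by rewrite -uE.
rewrite subn_gt0 ij /= ltn_subLR ?(ltnW ij)//; apply: leq_trans i5 _.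
by rewrite -[5%N]/(1 + 4)%N leq_add2r ltnW.
Qed.

Hypothesis c_inj : forall i j : nat, c ^+ i = c ^+ j -> i = j.

Let pos u i j : (u * c ^+ i == u * c ^+ j) = (i == j).
Proof. by apply/eqP/eqP => [/mulgI/c_inj|->]. Qed.

Let spin_flip_far x u g i : site x u -> site x g -> g != u -> (i < 5)%N ->
  spin (flip u x) (g * c ^+ i) = spin x (g * c ^+ i).
Proof.
move=> su sg gu i5; rewrite /spin /flip /swap.
by rewrite !(negbTE (site_disjoint su sg gu i5 _)).
Qed.

Let spin_flip x u i : i != 2%N -> i != 3%N ->
  spin (flip u x) (u * c ^+ i) = spin x (u * c ^+ i).
Proof. by move=> /negbTE i2 /negbTE i3; rewrite /spin /flip /swap !pos i2 i3. Qed.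

Let spin_flip2 x u : spin (flip u x) (u * c ^+ 2) = spin x (u * c ^+ 3).
Proof. by rewrite /spin /flip /swap eqxx. Qed.

Let spin_flip3 x u : spin (flip u x) (u * c ^+ 3) = spin x (u * c ^+ 2).
Proof. by rewrite /spin /flip /swap pos /= eqxx. Qed.

Let site_flip_imp x u g : site x u -> site x g -> site (flip u x) g.
Proof.
have E y h : site y h = [&& spin y (h * c ^+ 0), spin y (h * c ^+ 1),
    spin y (h * c ^+ 2) != spin y (h * c ^+ 3) & ~~ spin y (h * c ^+ 4)].
  by rewrite /site expg0 mulg1 expg1.
move=> su; have [->|gu] := eqVneq g u; last first.
  by move=> sg; move: (sg); rewrite [in X in X -> _]E E !(spin_flip_far su sg gu).
by rewrite [in X in X -> _]E E (@spin_flip _ _ 0%N)// (@spin_flip _ _ 1%N)// (@spin_flip _ _ 4%N)//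
  spin_flip2 spin_flip3 [X in ~~ X]eq_sym.
Qed.

(** Other sites do not meet the exchanged letters, and the condition on these letters is symmetric,
    so sites survive; the converse follows because [flip u] is an involution and [u] is still a site
    after it. *)
Lemma site_flip x u g : site x u -> site (flip u x) g = site x g.
Proof.
move=> su; have fu := site_flip_imp su su.
apply/idP/idP; last exact: site_flip_imp.
by move=> /(site_flip_imp fu); rewrite flipK.
Qed.

(** The exchanged letters of a site differ, so the exchange reverses its bit. *)
Lemma bit_flip x u g : site x u -> site x g -> bit (flip u x) g = bit x g (+) (g == u).
Proof.
move=> su sg; rewrite /bit; have [->|gu] := eqVneq g u.
  rewrite spin_flip2; case/and4P: su => _ _ + _.
  by case: (spin x _); case: (spin x _).
by rewrite addbF spin_flip_far.
Qed.

End sites.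

(** * Independent fair bits from parities along the forest *)

Section fair_bits.
Context (R : realType) (G : countGroupType) d (K : measurableType d).
Variables (kappa : probability K R) (A : set K) (p : R) (c : G) (v : nat * bool -> G).
Hypotheses (mA : measurable A) (kappaA : kappa A = p%:E) (p01 : (0 < p < 1)%R).
Hypothesis v_inj : injective (fun q : nat * bool * nat => v q.1 * c ^+ q.2)%g.
Hypothesis v_leaf : forall s : seq (G * nat), s <> [::] -> exists e b, e \in s /\
  forall e' b', e' \in s -> (e'.1 * v (e'.2, b') = e.1 * v (e.2, b))%g ->
    e' = e /\ b' = b.

Notation X := (prod_space G K).
Notation mu := (product_probability G kappa).
Implicit Types (x : X) (g u : G) (e j : G * nat).

Let c_inj (i j : nat) : (c ^+ i = c ^+ j)%g -> i = j.
Proof.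
by move=> ij; have [] : (0%N, false, i) = (0%N, false, j) by apply: v_inj; rewrite /= ij.
Qed.

(** A pair [(g, n)] names the edge of index [n] from [g], and the boolean chooses one of its
    endpoints. *)
Definition vertex e (b : bool) : G := (e.1 * v (e.2, b))%g.

Definition active x e := site A c x (vertex e false) && site A c x (vertex e true).

Definition parity x e := bit A c x (vertex e false) (+) bit A c x (vertex e true).

(* The edges reserved for [(g, k)] are those from [g] of index [pickle (k, i)]. *)
Definition edge j (i : nat) : G * nat := (j.1, pickle (j.2, i)).

Definition first_active x j i :=
  active x (edge j i) && all (fun m => ~~ active x (edge j m)) (iota 0 i).

(** The parity of the first active edge reserved for [j]; the value is [false] where there is none,
    which by [ae_active] is a null set. *)
Definition fair_bit x j : bool :=
  `[< exists i, first_active x j i && parity x (edge j i) >].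

Lemma edge_inj j j' i i' : edge j i = edge j' i' -> j = j' /\ i = i'.
Proof.
by case: j j' => [g k] [g' k'] [-> /(pcan_inj pickleK)[-> ->]].
Qed.

Lemma first_active_uniq x j i i' : first_active x j i -> first_active x j i' -> i = i'.
Proof.
move=> /andP[ai /allP ni] /andP[ai' /allP ni'].
case: (ltngtP i i') => // ii'.
- by have := ni' i; rewrite mem_iota ii' ai => /(_ isT).
- by have := ni i'; rewrite mem_iota ii' ai' => /(_ isT).
Qed.

Lemma fair_bit_first x j i : first_active x j i -> fair_bit x j = parity x (edge j i).
Proof.
move=> xi; apply/asboolP/idP => [[i' /andP[/(first_active_uniq xi) <-//]]|xp].
by exists i; rewrite xi.
Qed.

Let measurable_spin g : measurable [set x | spin A x g].
Proof.
rewrite (_ : [set x | _] = (fun x : X => x g) @^-1` A).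
  by rewrite -[_ @^-1` _]setTI; exact: measurable_coord.
by apply/seteqP; split=> x; rewrite /spin /= in_setE.
Qed.

Let measurable_site g : measurable [set x | site A c x g].
Proof.
do 2 apply: measurable_predI => //; apply: measurable_predI; last exact: measurable_predN.
have -> : [set x : X | spin A x (g * c ^+ 2)%g != spin A x (g * c ^+ 3)%g] =
    [set x | spin A x (g * c ^+ 2)%g (+) spin A x (g * c ^+ 3)%g].
  by apply/funext => x /=; case: (spin A x _); case: (spin A x _).
exact: measurable_predX.
Qed.

Let measurable_active e : measurable [set x | active x e].
Proof. exact: measurable_predI. Qed.

Let measurable_parity e : measurable [set x | parity x e].
Proof. by apply: measurable_predX; exact: measurable_spin. Qed.

Let measurable_first j i : measurable [set x | first_active x j i].
Proof.
apply: measurable_predI => //.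
apply: (@measurable_pred_all _ _ _ _ (fun m x => ~~ active x (edge j m))).
by move=> m; exact: measurable_predN.
Qed.

Lemma measurable_fair_bit j : measurable [set x | fair_bit x j].
Proof. by apply: measurable_pred_exists => i; exact: measurable_predI. Qed.

Let measurable_eqb (q : X -> bool) (b : bool) :
  measurable [set x | q x] -> measurable [set x | q x == b].
Proof.
move=> mq; case: b.
  by rewrite (_ : [set x | _] = [set x | q x])//; apply/funext => x /=; case: (q x).
rewrite (_ : [set x | _] = [set x | ~~ q x]); last by apply/funext => x /=; case: (q x).
exact: measurable_predN.
Qed.

Section fixed_edges.
Variables (J : seq (G * nat)) (i_ : G * nat -> nat) (b_ : G * nat -> bool).

Let firsts x := all (fun j => first_active x j (i_ j)) J.
Let parities (s : seq (G * nat)) x := all (fun j => parity x (edge j (i_ j)) == b_ j) s.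

Let measurable_firsts : measurable [set x | firsts x].
Proof. exact: (@measurable_pred_all _ _ _ _ (fun j x => first_active x j (i_ j))). Qed.

Let measurable_parities s : measurable [set x | parities s x].
Proof.
apply: (@measurable_pred_all _ _ _ _ (fun j x => parity x (edge j (i_ j)) == b_ j)).
by move=> j; exact: measurable_eqb.
Qed.

(* Flipping at a leaf of the forest of edges of [s] reverses one of the parities only. *)
Lemma parities_measure s : uniq s -> {subset s <= J} ->
  mu [set x | firsts x && parities s x] = (2^-1 ^+ size s)%:E * mu [set x | firsts x].
Proof.
elim: {s}(size s) {-2}s (erefl (size s)) => [|n ih] s sn us sJ.
  rewrite (size0nil sn) expr0 mul1e; congr (mu _).
  by apply/funext => x; rewrite /= andbT.
have [e [b []]] : exists e b, e \in [seq edge j (i_ j) | j <- s] /\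
    forall e' b', e' \in [seq edge j (i_ j) | j <- s] ->
      (e'.1 * v (e'.2, b') = e.1 * v (e.2, b))%g -> e' = e /\ b' = b.
  by apply: v_leaf; case: (s) sn.
move=> /mapP[j js ->{e}] leaf; pose u := vertex (edge j (i_ j)) b.
pose s' := rem j s; have s's : {subset s' <= s} by exact: mem_rem.
have us' : uniq s' by exact: rem_uniq.
have js' : j \notin s' by rewrite mem_rem_uniq ?inE ?eqxx.
have xu x : firsts x -> site A c x u.
  move=> /allP/(_ _ (sJ _ js))/andP[/andP[s0 s1] _].
  by rewrite /u; case: (b).
(* Flipping at a site preserves the set of sites, hence the active edges and which of them come
   first. *)
have flip_active x e : firsts x -> active (flip c u x) e = active x e.
  by move=> /xu xs; rewrite /active !site_flip.
have flip_firsts x : firsts x -> firsts (flip c u x).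
  move=> xf; rewrite /firsts (eq_all (a2 := fun j => first_active x j (i_ j)))// => k.
  rewrite /first_active flip_active//; congr (_ && _).
  by apply: eq_all => m /=; rewrite flip_active.
have flip_parity x k : firsts x -> k \in s ->
    parity (flip c u x) (edge k (i_ k)) = parity x (edge k (i_ k)) (+) (k == j).
  move=> xf ks; have /andP[/andP[s0 s1] _] := allP xf _ (sJ _ ks).
  have xs := xu _ xf.
  rewrite /parity !bit_flip// addbACA; congr (_ (+) _).
  (* By the leaf property, [u] is an endpoint of no other edge coming from [s], and only one
     endpoint of its own. *)
  have vu b' : (vertex (edge k (i_ k)) b' == u) = (k == j) && (b' == b).
    apply/eqP/andP => [/leaf|[/eqP -> /eqP ->]//].
    by move=> /(_ (map_f (fun j => edge j (i_ j)) ks))[/edge_inj[-> _] ->].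
  by rewrite !vu; case: (k == j); case: (b).
pose P (b' : bool) := [set x | (firsts x && parities s' x) && (parity x (edge j (i_ j)) == b')].
have flipP b' x : P b' x -> P (~~ b') (flip c u x).
  move=> /andP[/andP[xf /allP xp] /eqP xj]; apply/andP; split; [apply/andP; split|].
  - exact: flip_firsts.
  - apply/allP => k ks'; rewrite flip_parity ?s's//.
    rewrite (_ : (k == j) = false) ?addbF; first exact: xp.
    by apply/eqP => kj; rewrite -kj ks' in js'.
  - by rewrite flip_parity// xj eqxx addbT.
have mP b' : measurable (P b').
  apply: measurable_predI; first exact: measurable_predI.
  exact: measurable_eqb.
(* The flip permutes coordinates, so it preserves [mu], and it interchanges the two events: each is
   half of the event for [s']. *)
have muP : mu (P (~~ b_ j)) = mu (P (b_ j)).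
  rewrite -[RHS](product_probability_reindex kappa (swapK c u))//; congr (mu _).
  apply/seteqP; split=> x.
    by move=> /flipP; rewrite negbK.
  by move=> /flipP; rewrite -[fun g => x _]/(flip c u x) flipK.
have -> : [set x | firsts x && parities s x] = P (b_ j).
  apply/funext => x; rewrite /P /= -andbA; congr (is_true (_ && _)).
  by rewrite /parities (perm_all _ (perm_to_rem js))/= andbC.
have E : mu [set x | firsts x && parities s' x] = mu (P (b_ j)) + mu (P (b_ j)).
  rewrite -[X in _ + X]muP -measureU//; last first.
    by apply/seteqP; split=> // x [/andP[_ /eqP xj] /andP[_ /eqP]]; rewrite xj; case: (b_ j).
  congr (mu _); apply/seteqP; split=> x.
    move=> xs'; case: (eqVneq (parity x (edge j (i_ j))) (b_ j)) => [/eqP e|ne]; [left|right].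
      by apply/andP; split.
    by apply/andP; split => //; move: ne; case: (parity _ _); case: (b_ j).
  by case=> /andP[].
have sz : size s = (size s').+1 by rewrite size_rem// sn.
rewrite sz exprS EFinM -muleA -ih//; [|by rewrite /s' size_rem// sn|by move=> k /s's/sJ].
rewrite E; have /fineK <- : mu (P (b_ j)) \is a fin_num by exact: fin_num_measure.
by rewrite -EFinD -EFinM; congr EFin; rewrite -mulr2n -[X in (_ * X)%R]mulr_natl mulKf ?pnatr_eq0.
Qed.

End fixed_edges.

(** By [v_inj] the windows at the endpoints of the reserved edges are pairwise disjoint. Each edge
    thus has, independently, the same positive chance [p^6 (1-p)^4] of reading 11100 at both
    endpoints, and [avoid_boxes_null] applies. *)
Lemma ae_active j : mu [set x | forall i, ~~ active x (edge j i)] = 0.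
Proof.
pose pos i (q : bool * nat) := (vertex (edge j i) q.1 * c ^+ q.2)%g.
have pos_inj i i' q q' : pos i q = pos i' q' -> i = i' /\ q = q'.
  case: q q' => [b l] [b' l']; rewrite /pos /vertex /= -!mulgA => /mulgI.
  move=> /(@v_inj (pickle (j.2, i), b, l) (pickle (j.2, i'), b', l')).
  by case=> e -> ->; have [->] := pcan_inj pickleK e.
pose block k := [seq (b, l) | b <- [:: false; true], l <- iota 0 k].
pose I i := [seq pos i q | q <- block 5%N].
(* The word 11100 alone is prescribed: the first three places of each window lie in [A], the last
   two outside. *)
pose B i g := if g \in [seq pos i q | q <- block 3%N] then A else ~` A.
have mB i g : measurable (B i g) by rewrite /B; case: ifP => // _; exact: measurableC.
have mem_block k b l : ((b, l) \in block k) = (l < k)%N.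
  apply/allpairsP/idP => [[[b1 l1] /= [_ + [_ ->]]]|lk]; first by rewrite mem_iota add0n.
  by exists (b, l); split; rewrite ?mem_iota//=; case: b.
have uI i : uniq (I i).
  rewrite map_inj_uniq; last by move=> q q' /pos_inj[].
  by apply: allpairs_uniq; rewrite ?iota_uniq// => -[? ?] [? ?].
have BE i b l : B i (pos i (b, l)) = if (l < 3)%N then A else ~` A.
  rewrite /B mem_map ?mem_block// => q q'.
  by move=> /pos_inj[].
pose w (l : nat) : R := if (l < 3)%N then p else (1 - p)%R.
have /andP[p0 p1] := p01.
pose q : R := (\prod_(z <- block 5%N) w z.2)%R.
have null : mu [set x | forall i, ~ box (I i) (B i) x] = 0.
  apply: (@avoid_boxes_null _ _ _ _ _ _ _ q) => //.
  - by move=> i i' g /mapP[z _ ->] /mapP[z' _] /pos_inj[].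
  - move=> i; rewrite product_probability_box// big_map /q -prodEFin.
    apply: eq_bigr => -[b l] _; rewrite BE /w /=; case: ifP => // _.
    by rewrite probability_setC// kappaA EFinB.
  - apply: prodr_gt0 => z _; rewrite /w; case: ifP => // _.
    by rewrite subr_gt0.
apply/eqP; rewrite eq_le measure_ge0 andbT -null le_measure// ?inE//.
- rewrite (_ : [set x | _] = \bigcap_i [set x | ~~ active x (edge j i)]).
    by apply: bigcapT_measurable => i; exact: measurable_predN.
  by apply/seteqP; split=> [x xj i _|x xj i]; [exact: xj|exact: xj].
- rewrite (_ : [set x | _] = \bigcap_i (~` box (I i) (B i))).
    by apply: bigcapT_measurable => i; apply: measurableC; exact: measurable_box.
  by apply/seteqP; split=> [x xj i _|x xj i]; [exact: xj|exact: xj].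
- move=> x xj i bx; have /negP := xj i; apply.
  have spinE b l : (l < 5)%N -> spin A x (pos i (b, l)) = (l < 3)%N.
    move=> l5; have : pos i (b, l) \in I i by rewrite map_f// mem_block.
    move=> /bx; rewrite BE /spin; case: ifP => [_|_ nA]; first by move/mem_set.
    by apply/negbTE/negP => /set_mem.
  have siteE b : site A c x (vertex (edge j i) b).
    rewrite /site -[vertex _ b in X in X && _]mulg1.
    rewrite -[(_ * 1)%g]/(pos i (b, 0%N)) -[(_ * c)%g]/(pos i (b, 1%N)).
    rewrite -[(_ * c ^+ 2)%g]/(pos i (b, 2%N)) -[(_ * c ^+ 3)%g]/(pos i (b, 3%N)).
    by rewrite -[(_ * c ^+ 4)%g]/(pos i (b, 4%N)) !spinE.
  by rewrite /active !siteE.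
Qed.

(** Off the null set of [ae_active] there is a least active index, and its value partitions the
    space. *)
Lemma measure_first_active j (F : set X) : measurable F ->
  mu F = \sum_(n <oo) mu (F `&` [set x | first_active x j n]).
Proof.
move=> mF; pose U := \bigcup_n [set x | first_active x j n].
have mU : measurable U by exact: bigcupT_measurable.
have -> : mu F = mu (F `&` U).
  rewrite (measureDI mu mF mU) [X in X + _](_ : _ = 0) ?add0e//.
  apply/eqP; rewrite eq_le measure_ge0 andbT -(ae_active j) le_measure// ?inE//.
  - exact: measurableD.
  - rewrite (_ : [set x | _] = \bigcap_i [set x | ~~ active x (edge j i)]).
      by apply: bigcapT_measurable => i; exact: measurable_predN.
    by apply/seteqP; split=> [x xj i _|x xj i]; [exact: xj|exact: xj].
  - move=> x [_ xU] i; apply/negP => xi; apply: xU.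
    have ex : exists n, active x (edge j n) by exists i.
    exists (ex_minn ex) => //; case: ex_minnP => n xn nmin.
    rewrite /= /first_active xn; apply/allP => m; rewrite mem_iota add0n => /andP[_ mn].
    by apply/negP => /nmin; rewrite leqNgt mn.
rewrite setI_bigcupr measure_semi_bigcup//.
- by move=> n; exact: measurableI.
- apply/trivIsetP => n m _ _ nm; apply/seteqP; split=> // x [[_ xn] [_ xm]].
  by have := first_active_uniq xn xm; move/eqP: nm.
- by apply: bigcupT_measurable => n; exact: measurableI.
Qed.

Section joint_law.
Variable b_ : G * nat -> bool.

Let agree J x := all (fun j => fair_bit x j == b_ j) J.

Let measurable_agree J : measurable [set x | agree J x].
Proof.
apply: (@measurable_pred_all _ _ _ _ (fun j x => fair_bit x j == b_ j)) => j.
apply: measurable_eqb; exact: measurable_fair_bit.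
Qed.

Let firsts i_ J x := all (fun j => first_active x j (i_ j)) J.

Let measurable_firsts i_ J : measurable [set x | firsts i_ J x].
Proof. exact: (@measurable_pred_all _ _ _ _ (fun j x => first_active x j (i_ j))). Qed.

(** The first active edge is prescribed by [i_] for the indices in [J0] and still free for those in
    [J1]. The induction moves the last index of [J1] to [J0] by summing over its first active edge,
    down to [parities_measure]. *)
Let agree_firsts J1 J0 i_ : uniq (J1 ++ J0) ->
  mu [set x | firsts i_ J0 x && agree (J1 ++ J0) x] =
  (2^-1 ^+ size (J1 ++ J0))%:E * mu [set x | firsts i_ J0 x].
Proof.
elim/last_ind: J1 J0 i_ => [|J1 j ih] J0 i_ /=.
  move=> uJ; rewrite -(@parities_measure J0 i_ b_ J0)//; congr (mu _).
  apply/funext => x /=; congr is_true; rewrite -/(firsts i_ J0 x).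
  case: (boolP (firsts i_ J0 x)) => //= /allP xJ.
  by rewrite /agree; apply: eq_in_all => j jJ /=; rewrite (fair_bit_first (xJ j jJ)).
rewrite cat_rcons => uJ; pose i' n k := if k == j then n else i_ k.
have jJ0 : j \notin J0 by move: uJ; rewrite cat_uniq => /and3P[_ _ /andP[]].
have firstsE n x : firsts (i' n) (j :: J0) x = first_active x j n && firsts i_ J0 x.
  rewrite /firsts /= /i' eqxx; congr (_ && _); apply: eq_in_all => k kJ.
  by case: eqP => // kj; rewrite -kj kJ in jJ0.
rewrite (@measure_first_active j); last exact: measurable_predI.
rewrite [in RHS](@measure_first_active j)// -nneseriesZl//.
apply: eq_eseriesr => n _.
transitivity (mu [set x | firsts (i' n) (j :: J0) x && agree (J1 ++ j :: J0) x]).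
  congr (mu _); apply/seteqP; split=> x; rewrite /setI /mkset firstsE.
    by move=> [/andP[-> ->] ->].
  by move=> /andP[/andP[-> ->] ->].
rewrite ih//; congr (_ * mu _); apply/seteqP; split=> x; rewrite /setI /mkset firstsE.
  by move=> /andP[-> ->].
by move=> [-> ->].
Qed.

Lemma fair_bits_measure J : uniq J ->
  mu [set x | all (fun j => fair_bit x j == b_ j) J] = (2^-1 ^+ size J)%:E.
Proof.
move=> uJ; have := @agree_firsts J [::] (fun=> 0%N); rewrite !cats0 => /(_ uJ) /=.
rewrite (_ : [set x : X | true] = setT); last by apply/seteqP; split.
by rewrite probability_setT mule1.
Qed.

End joint_law.

End fair_bits.

(** * From fair bits to factor maps *)

Definition coin (R : realType) : probability bool R := bernoulli_prob (2^-1 : R).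
Arguments coin : clear implicits.

Lemma coinE (R : realType) (B : set bool) :
  coin R B = (2^-1)%:E * \d_true B + (2^-1)%:E * \d_false B.
Proof.
rewrite /coin /= bernoulli_probE; last by rewrite invr_ge0 invf_le1 ?ler1n ?ltr0n ?ler0n.
by congr (_ + _%:E * _); rewrite -[LHS]/(1 - 2^-1)%R; lra.
Qed.

Lemma fair_bits_law (R : realType) (I : countType) d (T : measurableType d)
    (mu : probability T R) (f : T -> prod_space I bool) :
  measurable_fun setT f ->
  (forall (b : I -> bool) J, uniq J ->
     mu [set x | all (fun j => f x j == b j) J] = (2^-1 ^+ size J)%:E) ->
  forall A, measurable A -> mu (f @^-1` A) = product_probability I (coin R) A.
Proof.
move=> mf fE; apply: product_probability_map => // J B uJ mB.
have mbox J' : measurable (f @^-1` box J' B).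
  by rewrite -[_ @^-1` _]setTI; apply: mf => //; exact: measurable_box.
have meq j b : measurable [set x | f x j == b].
  rewrite (_ : [set x | _] = (fun x => f x j) @^-1` [set b]).
    rewrite -[_ @^-1` _]setTI.
    by apply: (measurableT_comp (measurable_coord j) mf) => //.
  by apply/seteqP; split=> x /eqP.
have mall (b : I -> bool) J1 : measurable [set x | all (fun j => f x j == b j) J1].
  by apply: (@measurable_pred_all _ _ _ _ (fun j x => f x j == b j)).
(* The hypothesis covers prescribed values only. Here [J1] collects the indices whose value is
   prescribed by [b]; the induction moves an index from [J] to [J1], splitting its side of the box
   into points. *)
suff gen (b : I -> bool) J1 : uniq (J ++ J1) ->
    mu (f @^-1` box J B `&` [set x | all (fun j => f x j == b j) J1]) =
    (\prod_(j <- J) coin R (B j)) * (2^-1 ^+ size J1)%:E.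
  have := gen (fun=> true) [::]; rewrite cats0 expr0 mule1 => <- //.
  by congr (mu _); apply/seteqP; split=> x // [].
elim: J uJ b J1 => [_|j J ih /= /andP[jJ uJ]] b J1.
  rewrite /= big_nil mul1e => uJ1; rewrite -(fE b)//.
  by congr (mu _); apply/seteqP; split=> [x []//|x xJ]; split.
move=> /andP[]; rewrite mem_cat negb_or => /andP[_ jJ1] uJJ1.
pose b' c k := if k == j then c else b k.
pose F := f @^-1` box (j :: J) B `&` [set x | all (fun j => f x j == b j) J1].
have FE c : mu (F `&` [set x | f x j == c]) =
    \d_c (B j) * ((\prod_(j <- J) coin R (B j)) * (2^-1 ^+ (size J1).+1)%:E).
  have allE x : f x j = c -> all (fun j => f x j == b' c j) (j :: J1) =
      all (fun j => f x j == b j) J1.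
    move=> xj; rewrite /= /b' eqxx xj eqxx; apply: eq_in_all => k kJ1.
    by case: (eqVneq k j) => // kj; rewrite -kj kJ1 in jJ1.
  rewrite diracE; case: (boolP (c \in B j)) => cB; last first.
    rewrite mul0e (_ : _ `&` _ = set0) ?measure0//.
    apply/seteqP; split=> // x [[bx _] /eqP xj]; move/negP: cB; apply.
    by rewrite in_setE -xj; apply: bx; exact: mem_head.
  rewrite mul1e -(ih uJ (b' c) (j :: J1)); last first.
    by rewrite -cat_rcons -cats1 -catA uniq_catCA /= mem_cat negb_or jJ jJ1.
  congr (mu _); apply/seteqP; split=> x.
    move=> [[bx xJ1] /eqP xj]; split; first by move=> k kJ; apply: bx; rewrite inE kJ orbT.
    by rewrite /mkset allE.
  move=> [bx xJ1]; have xj : f x j = c.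
    by move: xJ1; rewrite /= /b' eqxx => /andP[/eqP].
  split; last exact/eqP.
  split; last by move: xJ1; rewrite /mkset allE.
  by move=> k; rewrite inE => /predU1P[->|/bx//]; rewrite xj -in_setE.
have mF : measurable F by exact: measurableI.
rewrite -/F (measureDI mu mF (meq j true)) addeC.
rewrite [X in mu _ + X](_ : _ = mu (F `&` [set x | f x j == false])); last first.
  by congr (mu _); apply/seteqP; split=> x [Fx] /=; case: (f x j); split.
have p0 : 0 <= \prod_(i <- J) coin R (B i) by exact: prode_ge0.
rewrite !FE big_cons coinE -ge0_muleDl// ?dirac_ge0//.
rewrite -ge0_muleDr// exprS EFinM.
by rewrite [X in _ = X * _ * _]muleC -!muleA; congr (_ * _); rewrite muleCA.
Qed.

(** The factor map is defined everywhere: extract bits indexed by [G * nat], give each element of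
    [G] its own sequence of bits, and apply [psi] to each sequence. *)
Lemma has_factor_map_of_fair_bits (R : realType) (G : countGroupType)
    (hG : contains_nonabelian_free_subgroup G) (dK dL : measure_display)
    (K : measurableType dK) (L : measurableType dL)
    (kappa : probability K R) (lambda : probability L R)
    (A : set K) (p : R) (psi : prod_space nat bool -> L) :
  measurable A -> kappa A = p%:E -> (0 < p < 1)%R ->
  measurable_fun setT psi ->
  (forall B, measurable B -> product_probability nat (coin R) (psi @^-1` B) = lambda B) ->
  has_factor_map (bernoulli_shift G kappa) (bernoulli_shift G lambda).
Proof.
move=> mA kA p01 mpsi psiE; have [c [v [v_inj v_leaf]]] := free_forest_leaf hG.
pose bits (x : prod_space G K) : prod_space (G * nat) bool := fair_bit A c v x.
pose curry (y : prod_space (G * nat) bool) : prod_space G (prod_space nat bool) :=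
  fun g k => y (g, k).
pose map_psi (z : prod_space G (prod_space nat bool)) : prod_space G L := psi \o z.
have mbits : measurable_fun setT bits.
  apply: measurable_to_prod => j; apply: measurable_pred_fun.
  exact: measurable_fair_bit.
have mcurry : measurable_fun setT curry by exact: measurable_prod_curry.
have mmap : measurable_fun setT map_psi by exact: measurable_comp_prod.
exists setT, (map_psi \o curry \o bits); split => //.
- exact: probability_setT.
- exact: (measurableT_comp mmap (measurableT_comp mcurry mbits)).
(* Edges and windows are placed by right multiplication, so the left shift by [h] merely translates
   them by [h^-1]. *)
- move=> h x _; apply/funext => g /=; congr psi; apply/funext => k.
  have vE (e : G * nat) b : vertex v ((h^-1 * e.1)%g, e.2) b = (h^-1 * vertex v e b)%g.
    by rewrite /vertex mulgA.
  have siteE (u : G) : site A c (Defs.shift h x) u = site A c x (h^-1 * u)%g.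
    by rewrite /site /spin /Defs.shift !mulgA.
  have activeE (e : G * nat) : active A c v (Defs.shift h x) e =
      active A c v x ((h^-1 * e.1)%g, e.2).
    by rewrite /active !siteE !vE.
  have parityE (e : G * nat) : parity A c v (Defs.shift h x) e =
      parity A c v x ((h^-1 * e.1)%g, e.2).
    by rewrite /parity /bit /spin /Defs.shift !vE !mulgA.
  rewrite /curry /bits /fair_bit; congr asbool.
  apply/eq_exists => i; rewrite parityE /first_active activeE.
  by congr (is_true (_ && _ && _)); apply: eq_all => m; rewrite activeE.
- move=> B mB; rewrite setTI.
  pose C := map_psi @^-1` B.
  have mC : measurable C by rewrite -[C]setTI; exact: mmap.
  have mC' : measurable (curry @^-1` C) by rewrite -[_ @^-1` _]setTI; exact: mcurry.
  rewrite -[LHS]/(product_probability G kappa (bits @^-1` (curry @^-1` C))).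
  rewrite (fair_bits_law mbits)//.
    (* Currying undoes uncurrying by conversion, so the event becomes [C] under the product over [G]
       of laws of coin sequences. *)
    rewrite -product_probability_uncurry//.
    exact: (product_probability_comp mpsi psiE mB).
  by move=> b J uJ; apply: (fair_bits_measure mA kA p01 v_inj v_leaf).
Qed.

(** * Sampling with fair coins *)

Section bit_prefixes.
Notation Z := (prod_space nat bool).
Implicit Types (z : Z) (w : seq bool).

(** The newest bit comes first, so that lengthening a prefix is a [cons]; hence the [rev] and [drop]
    in the lemmas that follow. *)
Fixpoint prefix (z : nat -> bool) n : seq bool :=
  if n is m.+1 then z m :: prefix z m else [::].

Lemma size_prefix z n : size (prefix z n) = n.
Proof. by elim: n => //= n ->. Qed.

Lemma eq_prefix (z z' : nat -> bool) n :
  prefix z n = prefix z' n <-> forall i, (i < n)%N -> z i = z' i.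
Proof.
elim: n => [|n ih] //=; split=> [[zn /ih zi] i|zi].
  by rewrite ltnS leq_eqVlt => /predU1P[->|/zi].
by rewrite zi//; congr (_ :: _); apply/ih => i /leqW; exact: zi.
Qed.

Lemma prefixK w : prefix (nth false (rev w)) (size w) = w.
Proof.
elim: w => //= b w ih; rewrite rev_cons nth_rcons size_rev ltnn eqxx.
congr (_ :: _); rewrite -[RHS]ih; apply/eq_prefix => i iw.
by rewrite nth_rcons size_rev iw.
Qed.

Lemma prefix_drop z m n : (m <= n)%N -> prefix z m = drop (n - m) (prefix z n).
Proof.
elim: n => [|n ih]; first by rewrite leqn0 => /eqP ->.
rewrite leq_eqVlt => /predU1P[->|]; first by rewrite subnn drop0.
by rewrite ltnS => mn; rewrite subSn//= ih.
Qed.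

Definition prefix_cylinder w : set Z := [set z | prefix z (size w) = w].

Lemma prefix_cylinder_box w :
  prefix_cylinder w = box (iota 0 (size w)) (fun i => [set nth false (rev w) i]).
Proof.
apply/seteqP; split=> z.
  rewrite /prefix_cylinder /= -[in X in _ = X -> _](prefixK w) => /eq_prefix zi i.
  by rewrite mem_iota => /zi.
move=> bz; rewrite /prefix_cylinder /= -[RHS]prefixK; apply/eq_prefix => i iw.
by apply: bz; rewrite mem_iota.
Qed.

Lemma measurable_prefix_cylinder w : measurable (prefix_cylinder w).
Proof. by rewrite prefix_cylinder_box; exact: measurable_box. Qed.

Lemma prefix_cylinder_cons b w :
  prefix_cylinder (b :: w) = prefix_cylinder w `&` [set z | z (size w) = b].
Proof.
apply/seteqP; split=> z; rewrite /prefix_cylinder /setI /mkset /=; first by case=> -> ->.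
by move=> [-> ->].
Qed.

(** Dropping the newest bits of the longer word leaves the only word of the shorter length
    compatible with it. With the empty set added, the cylinders are therefore closed under
    intersection. *)
Lemma prefix_cylinderI w w' : (size w <= size w')%N ->
  prefix_cylinder w `&` prefix_cylinder w' = prefix_cylinder w' \/
  prefix_cylinder w `&` prefix_cylinder w' = set0.
Proof.
move=> ww'; case: (eqVneq (drop (size w' - size w) w') w) => [e|/eqP e]; [left|right].
  apply/seteqP; split=> z; first by case.
  by move=> zw'; split=> //; rewrite /prefix_cylinder /mkset (prefix_drop _ ww') zw'.
by apply/seteqP; split=> // z [zw zw']; apply: e; rewrite -[X in drop _ X]zw' -prefix_drop.
Qed.

Lemma prefix_measure_unique (R : realType) (m1 m2 : {measure set Z -> \bar R}) :
  (m1 setT < +oo) -> (forall w, m1 (prefix_cylinder w) = m2 (prefix_cylinder w)) ->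
  forall A, measurable A -> m1 A = m2 A.
Proof.
move=> m1oo m12; pose C : set (set Z) := [set A | A = set0 \/ exists w, A = prefix_cylinder w].
have T0 : prefix_cylinder [::] = setT by apply/seteqP; split.
apply: (@measure_unique _ R Z C (fun=> setT)) => //.
- apply/seteqP; split; apply: smallest_sub.
  + exact: smallest_sigma_algebra.
  + move=> _ [i _ [B mB <-]]; rewrite setTI.
    have [u uK] : exists u : nat -> seq bool, forall w, u (pickle w) = w.
      by exists (fun n => odflt [::] (unpickle n)) => w; rewrite pickleK.
    (* The event that bit [i] lies in [B] is a countable union of cylinders of words of length
       [i.+1]; the head of such a word is bit [i]. *)
    rewrite (_ : _ @^-1` _ = \bigcup_n
        (if `[< size (u n) = i.+1 /\ B (head false (u n)) >] then prefix_cylinder (u n) else set0)).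
      apply: (@bigcupT_measurable _ (g_sigma_algebraType C)) => n.
      case: ifP => _; last exact: (@measurable0 _ (g_sigma_algebraType C)).
      by apply: sub_sigma_algebra; right; exists (u n).
    apply/seteqP; split=> z.
      move=> Bz; exists (pickle (prefix z i.+1)) => //; rewrite uK.
      case: asboolP => [_|[]]; last by rewrite size_prefix.
      by rewrite /prefix_cylinder /mkset size_prefix.
    move=> [n _]; case: asboolP => // -[wi Bw].
    by rewrite /prefix_cylinder /mkset wi => zw; move: Bw; rewrite -zw.
  + exact: sigma_algebra_measurable.
  + by move=> _ [->|[w ->]]; [exact: measurable0|exact: measurable_prefix_cylinder].
- move=> A B [->|[w ->]]; first by rewrite set0I; left.
  move=> [->|[w' ->]]; first by rewrite setI0; left.
  have [/prefix_cylinderI[|]->|/ltnW/prefix_cylinderI] := leqP (size w) (size w').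
  + by right; exists w'.
  + by left.
  + by rewrite setIC => -[->|->]; [right; exists w|left].
- by move=> _; right; exists [::].
- by apply/seteqP; split=> // z _; exists 0%N.
- by move=> A [->|[w ->]//]; rewrite !measure0.
Qed.

End bit_prefixes.

(* [cut s] plays the event [U < s] for a uniform [U]; the prefix [w] is selected when
   [U] lies in the interval [lower w, lower w + mass w), these intervals being laid out
   in lexicographic order. *)
Section inverse_sampling.
Context (R : realType) d (T : measurableType d) (mu : probability T R).
Variable cut : R -> set T.
Hypotheses (measurable_cut : forall s, measurable (cut s))
  (cut0 : cut 0%R = set0) (cut1 : cut 1%R = setT)
  (le_cut : forall s t, (s <= t)%R -> cut s `<=` cut t)
  (mu_cut : forall s, (0 <= s <= 1)%R -> mu (cut s) = s%:E).
Variable rho : probability (prod_space nat bool) R.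

Let mass w := fine (rho (prefix_cylinder w)).

Let rhoE w : rho (prefix_cylinder w) = (mass w)%:E.
Proof. by rewrite fineK// fin_num_measure//; exact: measurable_prefix_cylinder. Qed.

Let mass_ge0 w : (0 <= mass w)%R. Proof. exact: fine_ge0. Qed.

Let mass_split w : mass w = (mass (false :: w) + mass (true :: w))%R.
Proof.
apply: EFin_inj; rewrite EFinD -!rhoE -measureU; [|exact: measurable_prefix_cylinder..|].
  congr (rho _); rewrite !prefix_cylinder_cons -setIUr.
  rewrite -[LHS]setIT; congr (_ `&` _).
  by apply/seteqP; split=> // z _ /=; case: (z _); [right|left].
by rewrite !prefix_cylinder_cons; apply/seteqP; split=> // z [[_ /= ->] []].
Qed.

Fixpoint lower w : R :=
  if w is b :: w' then (lower w' + if b then mass (false :: w') else 0)%R else 0%R.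

Let lower_itv w : (0 <= lower w)%R /\ (lower w + mass w <= 1)%R.
Proof.
elim: w => [|b w [l0 l1]] /=.
  split=> //; rewrite add0r -lee_fin -rhoE; apply: probability_le1.
  exact: measurable_prefix_cylinder.
have := mass_split w; have := mass_ge0 (false :: w); have := mass_ge0 (true :: w).
by move=> m1 m0 mw; case: b; split; lra.
Qed.

Fixpoint sample_prefix (x : T) n : seq bool :=
  if n is m.+1 then
    let w := sample_prefix x m in (x \notin cut (lower w + mass (false :: w))) :: w
  else [::].

Definition sample (x : T) : prod_space nat bool := fun n => head false (sample_prefix x n.+1).

Lemma prefix_sample x n : prefix (sample x) n = sample_prefix x n.
Proof. by elim: n => //= n ->. Qed.

(** Induction on [w]: the test made after [w] divides its interval at [lower w + mass (false :: w)],
    the part inside the cut going to [false] and the rest to [true]. *)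
Lemma sample_prefixE w : sample @^-1` prefix_cylinder w =
  cut (lower w + mass w) `\` cut (lower w).
Proof.
have -> : sample @^-1` prefix_cylinder w = [set x | sample_prefix x (size w) = w].
  by apply/seteqP; split=> x; rewrite /prefix_cylinder /= prefix_sample.
elim: w => [|b w ih].
  have -> : mass [::] = 1%R.
    rewrite /mass (_ : prefix_cylinder [::] = setT) ?probability_setT//.
    by apply/seteqP; split.
  by rewrite add0r cut1 /= cut0 setD0; apply/seteqP; split.
have -> : [set x | sample_prefix x (size (b :: w)) = b :: w] =
    (cut (lower w + mass w) `\` cut (lower w)) `&`
    [set x | (x \notin cut (lower w + mass (false :: w))) = b].
  rewrite -ih; apply/seteqP; split=> x /=; first by move=> [<- ->].
  by move=> [-> ->].
have m0 := mass_ge0 (false :: w); have m1 := mass_ge0 (true :: w).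
have mw := mass_split w; case: b => /=; last first.
  rewrite addr0; apply/seteqP; split=> x.
    by move=> [[_ xl] /negbT]; rewrite negbK in_setE.
  move=> [xm xl]; split; last by apply/negbTE; rewrite negbK in_setE.
  by split=> //; apply: le_cut xm; lra.
have -> : (lower w + mass (false :: w) + mass (true :: w) = lower w + mass w)%R by lra.
apply/seteqP; split=> x; first by move=> [[xu _]] /negP; rewrite in_setE.
move=> [xu xm]; split; last by apply/negP; rewrite in_setE.
by split=> // xl; apply: xm; apply: le_cut xl; lra.
Qed.

Lemma measurable_sample : measurable_fun setT sample.
Proof.
have mpre w : measurable (sample @^-1` prefix_cylinder w).
  by rewrite sample_prefixE; exact: measurableD.
apply: measurable_to_prod => n; apply: measurable_pred_fun.
have [u uK] : exists u : nat -> seq bool, forall w, u (pickle w) = w.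
  by exists (fun n => odflt [::] (unpickle n)) => w; rewrite pickleK.
rewrite (_ : [set x | _] = \bigcup_k (if (size (u k) == n.+1) && head false (u k)
    then sample @^-1` prefix_cylinder (u k) else set0)).
  by apply: bigcupT_measurable => k; case: ifP.
apply/seteqP; split=> x.
  move=> xn; exists (pickle (prefix (sample x) n.+1)) => //; rewrite uK.
  have -> : head false (prefix (sample x) n.+1) by exact: xn.
  by rewrite size_prefix eqxx /prefix_cylinder /preimage /mkset size_prefix.
move=> [k _]; case: ifP => // /andP[/eqP wn w1].
by rewrite /prefix_cylinder /preimage /mkset wn => xw; move: w1; rewrite -xw.
Qed.

(** The interval of [w] has length [mass w], so both laws agree on the prefix cylinders, which
    determine them. *)
Lemma sample_law A : measurable A -> mu (sample @^-1` A) = rho A.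
Proof.
have [nu nuE] : exists nu : {measure set (prod_space nat bool) -> \bar R},
    forall B, nu B = mu (sample @^-1` B).
  by unshelve eexists (pushforward mu sample) => //; exact: measurable_sample.
rewrite -nuE; apply: prefix_measure_unique => [|w]; rewrite nuE.
  by rewrite preimage_setT probability_setT ltry.
have [l0 l1] := lower_itv w; have m0 := mass_ge0 w.
rewrite sample_prefixE measureD//; last first.
  by rewrite -[X in X < _]/(mu _) mu_cut ?ltry//; apply/andP; split; lra.
rewrite setIidr; last by apply: le_cut; rewrite lerDl.
rewrite -[X in X - _]/(mu _) -[X in _ - X]/(mu _) !mu_cut; [|apply/andP; split; lra..].
by rewrite -[RHS]/(rho _) rhoE -EFinB; congr EFin; lra.
Qed.

End inverse_sampling.

(** * A uniform variable from coin tosses *)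

Section binary_expansion.
Context (R : realType).
Notation Z := (prod_space nat bool).
Notation mu := (product_probability nat (coin R)).

(** The head is the least significant digit, so in a prefix the earliest toss is the most
    significant one. *)
Fixpoint binary_value (w : seq bool) : nat :=
  if w is b :: w' then (b + (binary_value w').*2)%N else 0%N.

Fixpoint binary_word (n k : nat) : seq bool :=
  if n is m.+1 then odd k :: binary_word m k./2 else [::].

Lemma size_binary_word n k : size (binary_word n k) = n.
Proof. by elim: n k => //= n ih k; rewrite ih. Qed.

Lemma binary_wordK n k : (k < 2 ^ n)%N -> binary_value (binary_word n k) = k.
Proof.
elim: n k => [|n ih] k /=; first by case: k.
rewrite expnS mul2n => kn; rewrite ih ?odd_double_half//.
by rewrite -ltn_double (leq_ltn_trans _ kn)// -[leqRHS]odd_double_half leq_addl.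
Qed.

Lemma binary_valueK w : binary_word (size w) (binary_value w) = w.
Proof.
elim: w => //= b w ih; rewrite oddD odd_double addbF oddb.
by rewrite half_bit_double ih.
Qed.

Lemma binary_value_lt w : (binary_value w < 2 ^ size w)%N.
Proof.
elim: w => //= b w ih; rewrite expnS mul2n.
apply: (@leq_trans (binary_value w).+1.*2); last by rewrite leq_double.
by rewrite doubleS ltnS; case: b; rewrite ?add1n ?add0n// leqW.
Qed.

Lemma coin_prefix w : mu (prefix_cylinder w) = (2^-1 ^+ size w)%:E.
Proof.
have coin1 b : coin R [set b] = (2^-1)%:E.
  have E c : (c \in [set b]) = (c == b) by apply/idP/eqP; rewrite in_setE.
  by rewrite coinE !diracE !E; case: b {E}; rewrite /= ?mule0 ?mule1 ?add0e ?adde0.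
rewrite prefix_cylinder_box product_probability_box ?iota_uniq//.
under eq_bigr do rewrite coin1.
by rewrite prodEFin big_const_seq count_predT size_iota iter_mulr_1.
Qed.

Definition coin_value (x : Z) n : nat := binary_value (prefix x n).

Lemma coin_valueE n k : [set x | coin_value x n = k] =
  if (k < 2 ^ n)%N then prefix_cylinder (binary_word n k) else set0.
Proof.
case: ltnP => [kn|nk].
  rewrite /prefix_cylinder size_binary_word; apply/seteqP; split=> x /=.
    by move=> <-; have := binary_valueK (prefix x n); rewrite size_prefix.
  by rewrite /coin_value => ->; rewrite binary_wordK.
apply/seteqP; split=> // x /= xk.
by have := binary_value_lt (prefix x n); rewrite -/(coin_value x n) size_prefix xk ltnNge nk.
Qed.

Lemma coin_value_ltS n k : [set x | (coin_value x n < k.+1)%N] =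
  [set x | (coin_value x n < k)%N] `|` [set x | coin_value x n = k].
Proof.
apply/seteqP; split=> x /=; last by move=> [/ltnW|->].
by rewrite ltnS leq_eqVlt => /predU1P[->|]; [right|left].
Qed.

Lemma measurable_coin_value n k : measurable [set x | coin_value x n = k].
Proof. by rewrite coin_valueE; case: ifP => // _; exact: measurable_prefix_cylinder. Qed.

Lemma measurable_coin_value_lt n k : measurable [set x | (coin_value x n < k)%N].
Proof.
elim: k => [|k ih]; first by rewrite (_ : [set x | _] = set0)//; apply/seteqP; split.
by rewrite coin_value_ltS; apply: measurableU => //; exact: measurable_coin_value.
Qed.

Lemma coin_value_lt_measure n k : (k <= 2 ^ n)%N ->
  mu [set x | (coin_value x n < k)%N] = (k%:R * 2^-1 ^+ n)%:E.
Proof.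
elim: k => [_|k ih kn].
  by rewrite mul0r (_ : [set x | _] = set0) ?measure0//; apply/seteqP; split.
rewrite coin_value_ltS measureU; [|exact: measurable_coin_value_lt|exact: measurable_coin_value|].
  rewrite -[X in X + _]/(mu _) -[X in _ + X]/(mu _) ih 1?ltnW// coin_valueE kn coin_prefix.
  by rewrite size_binary_word -EFinD -[(k.+1)%:R%R]natr1 mulrDl mul1r.
by apply/seteqP; split=> // x /= [+ xk]; rewrite xk ltnn.
Qed.

(* [coin_value x n / 2^n] increases to the uniform variable with binary digits [x]. *)
Definition coin_cut (s : R) : set Z :=
  [set x | forall n, ((coin_value x n)%:R < s * 2 ^+ n)%R].

Lemma coin_cut0 : coin_cut 0%R = set0.
Proof. by apply/seteqP; split=> // x /(_ 0%N); rewrite mul0r ltxx. Qed.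

Lemma coin_cut1 : coin_cut 1%R = setT.
Proof.
apply/seteqP; split=> // x _ n; rewrite mul1r -natrX ltr_nat.
by have := binary_value_lt (prefix x n); rewrite size_prefix.
Qed.

Lemma le_coin_cut s t : (s <= t)%R -> coin_cut s `<=` coin_cut t.
Proof.
move=> st x xs n; apply: lt_le_trans (xs n) _.
by rewrite ler_wpM2r// exprn_ge0.
Qed.

Let approx (s : R) n : set Z := [set x | ((coin_value x n)%:R < s * 2 ^+ n)%R].

Let coin_cutE s : coin_cut s = \bigcap_n approx s n.
Proof. by apply/seteqP; split=> [x xs n _|x xs n]; [exact: xs|exact: xs]. Qed.

(** The witness is the ceiling of [s * 2^n]: its truncation if that number is an integer, and one
    more otherwise. *)
Let approxE s n : (0 <= s <= 1)%R -> exists k : nat,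
  [/\ (k <= 2 ^ n)%N, (s * 2 ^+ n <= k%:R <= s * 2 ^+ n + 1)%R &
   approx s n = [set x | (coin_value x n < k)%N]].
Proof.
move=> /andP[s0 s1]; set t := (s * 2 ^+ n)%R.
have /truncn_itv/andP[kl kr] : (0 <= t)%R by rewrite mulr_ge0// exprn_ge0.
have tn : (t <= (2 ^ n)%:R)%R by rewrite natrX ler_piMl// exprn_ge0.
move: kl; rewrite le_eqVlt => /predU1P[ks|kl].
  exists (Num.truncn t); split.
  - by rewrite -(ler_nat R) ks.
  - by rewrite ks lexx lerDl ler01.
  - by apply/seteqP; split=> x; rewrite /approx /mkset -/t -[X in (_ < X)%R]ks ltr_nat.
exists (Num.truncn t).+1; split.
- by rewrite -(ltr_nat R); exact: lt_le_trans tn.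
- by rewrite (ltW kr) -natr1 lerD2r ltW.
apply/seteqP; split=> x; rewrite /approx /mkset -/t => xs.
  by rewrite -(ltr_nat R); exact: lt_trans kr.
by apply: le_lt_trans kl; rewrite ler_nat -ltnS.
Qed.

Lemma measurable_coin_cut s : measurable (coin_cut s).
Proof.
rewrite coin_cutE; apply: bigcapT_measurable => n; rewrite /approx.
rewrite (_ : [set x | _] = \bigcup_k [set x | coin_value x n = k /\ (k%:R < s * 2 ^+ n)%R]).
  apply: bigcupT_measurable => k; case: (boolP (k%:R < s * 2 ^+ n)%R) => ks.
    rewrite (_ : [set x | _] = [set x | coin_value x n = k]); first exact: measurable_coin_value.
    by apply/seteqP; split=> x // [].
  by rewrite (_ : [set x | _] = set0)//; apply/seteqP; split=> // x [].
by apply/seteqP; split=> [x xs|x [k _ [<-]]//]; exists (coin_value x n).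
Qed.

(** The events [approx s n] decrease to [coin_cut s] and have measure between [s] and [s + 2^-n].
    Inclusion gives the upper bound, continuity from above the lower one. *)
Lemma coin_cut_measure s : (0 <= s <= 1)%R -> mu (coin_cut s) = s%:E.
Proof.
move=> s01; have mapprox n : measurable (approx s n).
  by have [k [_ _ ->]] := approxE n s01; exact: measurable_coin_value_lt.
have bound n : s%:E <= mu (approx s n) <= (s + 2^-1 ^+ n)%:E.
  have [k [kn /andP[sk ks] ->]] := approxE n s01.
  have p0 : (0 < 2 ^+ n :> R)%R by rewrite exprn_gt0.
  rewrite coin_value_lt_measure// !lee_fin exprVn ler_pdivlMr// sk /=.
  by rewrite ler_pdivrMr// mulrDl mulVf// gt_eqF.
have fin : mu (coin_cut s) \is a fin_num by apply: fin_num_measure; exact: measurable_coin_cut.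
apply/eqP; rewrite eq_le; apply/andP; split.
  rewrite -(fineK fin) lee_fin; have lt1 : (`|2^-1 : R| < 1)%R.
    by rewrite ger0_norm// invf_lt1// ltr1n.
  have cv := @cvg_expr R _ lt1.
  have lims : limn (fun n => s + 2^-1 ^+ n)%R = s.
    by apply: cvg_lim => //; rewrite -[X in _ --> X]addr0; apply: cvgD => //; exact: cvg_cst.
  rewrite -[leRHS]lims; apply: limr_ge; first by apply: is_cvgD; [exact: is_cvg_cst|exact: cvgP cv].
  apply: nearW => n; rewrite -lee_fin fineK//.
  have /andP[_] := bound n; apply: le_trans; apply: le_measure; rewrite ?inE//.
    exact: measurable_coin_cut.
  by move=> x xs; exact: (xs n).
have cv : mu \o approx s @ \oo --> mu (coin_cut s).
  rewrite coin_cutE; apply: nonincreasing_cvg_mu => //.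
  - by rewrite (le_lt_trans (probability_le1 _ _))// ltry.
  - by rewrite -coin_cutE; exact: measurable_coin_cut.
  (* One more digit at least doubles [coin_value]. *)
  apply/nonincreasing_seqP => n; rewrite subsetEset => x; rewrite /approx /mkset.
  rewrite exprS mulrCA -ltr_pdivrMl// => /le_lt_trans; apply.
  rewrite ler_pdivlMl// -natrM ler_nat /coin_value /= mul2n.
  exact: leq_addl.
rewrite -(cvg_lim _ cv)//; apply: lime_ge; first exact: cvgP cv.
by apply: nearW => n /=; have /andP[] := bound n.
Qed.

End binary_expansion.

(** Inverse transform sampling, with the uniform variable read off the coins through [coin_cut]. *)
Lemma coin_universal (R : realType) (rho : probability (prod_space nat bool) R) :
  exists theta : prod_space nat bool -> prod_space nat bool,
    measurable_fun setT theta /\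
    forall A, measurable A -> product_probability nat (coin R) (theta @^-1` A) = rho A.
Proof.
exists (sample (@coin_cut R) rho); split.
  apply: measurable_sample;
    [exact: measurable_coin_cut|exact: coin_cut0|exact: coin_cut1|exact: le_coin_cut].
apply: sample_law;
  [exact: measurable_coin_cut|exact: coin_cut0|exact: coin_cut1|exact: le_coin_cut|].
exact: coin_cut_measure.
Qed.

(** * Standard Borel spaces *)

Lemma exists_half_expr_lt (R : realType) (e : R) : (0 < e)%R -> exists n : nat, (2^-1 ^+ n < e)%R.
Proof.
move=> e0; have lt1 : (`|2^-1 : R| < 1)%R by rewrite ger0_norm// invf_lt1// ltr1n.
have /cvgrPdist_lt/(_ e e0)[N _ /(_ N (leqnn N))] := cvg_expr lt1.
by rewrite sub0r normrN ger0_norm; [exists N|rewrite exprn_ge0].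
Qed.

(* A point [x] is coded by the bits "[x] lies within [2^-n] of the [k]-th dense point"; it is
   recovered as the limit of the first dense points so recorded. Completeness makes the set of
   decodable bit sequences Borel. *)
Section decoding.
Context (R : realType) (P : metricType R) (q : nat -> P).
Hypothesis complete : forall F : set_system P, ProperFilter F -> cauchy F -> exists p : P, F --> p.
Hypothesis q_dense : forall x (e : R), (0 < e)%R -> exists k, (mdist x (q k) < e)%R.
Notation Z := (prod_space nat bool).
Implicit Types (b : Z) (x y : P).

Let r n : R := (2^-1 ^+ n)%R.

Let r_gt0 n : (0 < r n)%R. Proof. by rewrite exprn_gt0// invr_gt0. Qed.

Let rS n : (r n = 2 * r n.+1)%R.
Proof. by rewrite /r exprS mulrA mulfV ?mul1r// pnatr_eq0. Qed.

Definition encode x : Z := fun m =>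
  if unpickle m is Some (n, k) then (mdist x (q k) < 2^-1 ^+ n)%R else false.

Let bitnk b (n k : nat) : bool := b (pickle (n, k)).

Let encodeE x n k : bitnk (encode x) n k = (mdist x (q k) < r n)%R.
Proof. by rewrite /bitnk /encode pickleK. Qed.

Let code b n k := bitnk b n k && all (fun m => ~~ bitnk b n m) (iota 0 k).

Let code_uniq b n k k' : code b n k -> code b n k' -> k = k'.
Proof.
move=> /andP[bk /allP nk] /andP[bk' /allP nk'].
case: (ltngtP k k') => // kk'.
- by have := nk' k; rewrite mem_iota kk' bk => /(_ isT).
- by have := nk k'; rewrite mem_iota kk' bk' => /(_ isT).
Qed.

Let code_encode x n : exists k, code (encode x) n k /\ (mdist x (q k) < r n)%R.
Proof.
have [k0 xk0] := q_dense x (r_gt0 n).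
have ex : exists k, bitnk (encode x) n k by exists k0; rewrite encodeE.
exists (ex_minn ex); case: ex_minnP => k xk kmin; rewrite -encodeE xk; split=> //.
rewrite /code xk; apply/allP => m; rewrite mem_iota add0n => /andP[_ mk].
by apply/negP => /kmin; rewrite leqNgt mk.
Qed.

(** In the code of a point, the dense points recorded at levels [n] and [n.+1] are within
    [r n + r n.+1], hence within [2 * r n], of each other. *)
Let decodable b := forall n, exists k k',
  [/\ code b n k, code b n.+1 k' & (mdist (q k) (q k') <= 2 * r n)%R].

(** The constant 4 comes from summing [2 * r m] over all [m >= n], which bounds the distance from
    the recorded point to the limit. *)
Let decodes b x := decodable b /\
  forall n, exists k, code b n k /\ (mdist x (q k) <= 4 * r n)%R.

Let encodeK x : decodes (encode x) x.
Proof.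
split=> n; have [k [ck xk]] := code_encode x n; last first.
  by exists k; split=> //; have := r_gt0 n; lra.
have [k' [ck' xk']] := code_encode x n.+1; exists k, k'; split=> //.
have := metric_triangle (q k) x (q k'); rewrite (metric_sym (q k) x) => tr.
apply: le_trans tr _; have := rS n; have := r_gt0 n.+1; lra.
Qed.

Let decodes_uniq b x y : decodes b x -> decodes b y -> x = y.
Proof.
move=> [_ bx] [_ bY]; apply: mdist_positivity; apply/eqP; rewrite eq_le mdist_ge0 andbT.
apply/ler_addgt0Pr => e e0; rewrite add0r.
have e8 : (0 < e / 8)%R by rewrite divr_gt0.
have [n ne] := exists_half_expr_lt e8.
have [k [ck xk]] := bx n; have [k' [ck' yk]] := bY n.
have kk' := code_uniq ck ck'; subst k'.
have := metric_triangle x (q k) y; rewrite (metric_sym (q k) y) => tr.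
by apply: le_trans tr _; move: ne xk yk; rewrite -/(r n); lra.
Qed.

Let decodable_decodes b : decodable b -> exists x, decodes b x.
Proof.
move=> bE; have /choice[k kP] : forall n, exists k, code b n k.
  by move=> n; have [k [k' [ck _ _]]] := bE n; exists k.
have step n : (mdist (q (k n)) (q (k n.+1)) <= 2 * r n)%R.
  have [l [l' [cl cl' ll']]] := bE n.
  by rewrite (code_uniq (kP n) cl) (code_uniq (kP n.+1) cl').
(* The bound telescopes, since [2 * r m = 4 * r m - 4 * r m.+1]. *)
have far n j : (mdist (q (k n)) (q (k (n + j)%N)) <= 4 * r n - 4 * r (n + j)%N)%R.
  elim: j => [|j ih]; first by rewrite addn0 mdistxx subrr.
  have := metric_triangle (q (k n)) (q (k (n + j)%N)) (q (k (n + j.+1)%N)) => tr.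
  apply: le_trans tr _; have := step (n + j)%N; rewrite addnS; have := rS (n + j)%N.
  by lra.
have cau : cauchy ((q \o k) @ \oo).
  apply: cauchy_exP => e e0; have e4 : (0 < e / 4)%R by rewrite divr_gt0.
  have [n ne] := exists_half_expr_lt e4; exists (q (k n)).
  exists n => // m /= nm; rewrite ballEmdist /=.
  have := far n (m - n)%N; rewrite subnKC// => le.
  by apply: le_lt_trans le _; have := r_gt0 m; move: ne; rewrite -/(r n); lra.
have [x xP] := complete _ cau; exists x; split=> // n; exists (k n); split=> //.
apply/ler_addgt0Pr => e e0.
have /cvg_ballP/(_ e e0)[N _ NP] := xP.
have /NP : (N <= n + N)%N by exact: leq_addl.
rewrite ballEmdist /= => xm.
have := metric_triangle x (q (k (n + N)%N)) (q (k n)) => tr.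
apply: le_trans tr _; rewrite (metric_sym (q (k (n + N)%N))).
by have := far n N; have := r_gt0 (n + N)%N; lra.
Qed.

Let measurable_bitnk n k : measurable [set b | bitnk b n k].
Proof.
rewrite (_ : [set b | _] = (fun b : Z => b (pickle (n, k))) @^-1` [set true]).
  by rewrite -[_ @^-1` _]setTI; exact: measurable_coord.
by apply/seteqP; split=> b.
Qed.

Let measurable_code n k : measurable [set b | code b n k].
Proof.
apply: measurable_predI => //.
apply: (@measurable_pred_all _ _ _ _ (fun m b => ~~ bitnk b n m)) => m.
exact: measurable_predN.
Qed.

Let measurable_decodable : measurable [set b | decodable b].
Proof.
rewrite (_ : [set b | _] = \bigcap_n \bigcup_k \bigcup_k'
    [set b | (code b n k && code b n.+1 k') && (mdist (q k) (q k') <= 2 * r n)%R]).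
  apply: bigcapT_measurable => n; do 2 apply: bigcupT_measurable => ?.
  apply: measurable_predI; first exact: measurable_predI.
  case: (_ <= _)%R; first by rewrite (_ : [set x | _] = setT)//; apply/seteqP; split.
  by rewrite (_ : [set x | _] = set0)//; apply/seteqP; split.
apply/seteqP; split=> b bE n; first move=> _.
  have [k [k' [ck ck' kk']]] := bE n; exists k => //; exists k' => //.
  by rewrite /mkset ck ck' kk'.
by have [k _ [k' _ /andP[/andP[ck ck'] kk']]] := bE n Logic.I; exists k, k'.
Qed.

Variable x0 : P.

Definition decode b : P := xget x0 [set x | decodes b x].

Lemma decode_encode x : decode (encode x) = x.
Proof.
rewrite /decode; case: xgetP => [y _ /decodes_uniq|/(_ x)]; first by apply; exact: encodeK.
by have := encodeK x.
Qed.

(** It suffices to treat an open [U]. A decodable sequence is sent into [U] exactly when, for some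
    [n], the ball of radius [5 * r n] about its recorded point lies in [U]: the decoded point is
    within [4 * r n] of that centre. All other sequences go to [x0]. *)
Lemma measurable_decode (S : set P) : <<s @open P >> S -> measurable (decode @^-1` S).
Proof.
move: S; apply: smallest_sub; first split.
- by rewrite preimage_set0.
- by move=> S mS; rewrite setTD preimage_setC; exact: measurableC.
- by move=> S mS; rewrite preimage_bigcup; exact: bigcupT_measurable.
move=> U oU /=; rewrite (_ : decode @^-1` U =
    ([set b | decodable b] `&` \bigcup_n \bigcup_k
      (if `[< forall y, (mdist (q k) y < 5 * r n)%R -> U y >] then [set b | code b n k] else set0))
    `|` (~` [set b | decodable b] `&` (if `[< U x0 >] then setT else set0))).
  apply: measurableU; apply: measurableI => //.
  - by do 2 apply: bigcupT_measurable => ?; case: ifP.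
  - exact: measurableC.
  - by case: ifP.
apply/seteqP; split=> b; last first.
  move=> [[bE [n _ [k _]]]|[nbE]]; rewrite /preimage /mkset /decode.
    case: asboolP => // kU ck; case: xgetP => [x _ [_ /(_ n)[k' [ck' xk']]]|none]; last first.
      by have [x bx] := decodable_decodes bE; have := none x.
    have kk' := code_uniq ck ck'; subst k'.
    by apply: kU; rewrite metric_sym; have := r_gt0 n; move: xk'; lra.
  case: asboolP => // Ux0 _; case: xgetP => [x _ [bE _]|_]; last exact: Ux0.
  by have := nbE bE.
rewrite /preimage /mkset /decode; case: xgetP => [x _ [bE bx] Ux|none Ux0]; [left|right].
  split=> //; have /nbhs_ballP[e /= e0 eU] : nbhs x U by exact: open_nbhs_nbhs.
  (* The ball of radius [5 * r n] about a centre within [4 * r n] of [x] lies in the ball of radius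
     [9 * r n] about [x]. *)
  have e9 : (0 < e / 9)%R by rewrite divr_gt0.
  have [n ne] := exists_half_expr_lt e9; have [k [ck xk]] := bx n.
  exists n => //; exists k => //; case: asboolP => // nU; exfalso; apply: nU => y ky.
  apply: eU; rewrite ballEmdist /=.
  have tr := metric_triangle x (q k) y; apply: le_lt_trans tr _.
  by move: ne; rewrite -/(r n); lra.
split; last by case: asboolP.
by move=> /decodable_decodes[x bx]; have := none x.
Qed.

End decoding.

(** This exhibits [K] as a measurable retract of the space of bit sequences, the only form in which
    the standard Borel hypothesis enters below. *)
Lemma standard_borel_retract (R : realType) d (K : measurableType d) : standard_borel R K ->
  exists (h : K -> prod_space nat bool) (g : prod_space nat bool -> K),
    [/\ measurable_fun setT h, measurable_fun setT g & cancel h g].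
Proof.
move=> [P [f [complete [D /countable_injP[i iD] dD] [f' fK f'K] fB]]].
pose x0 := f point.
(* The dense set may be finite; numbers that [i] does not attain on [D] get the value [x0]. *)
pose q k := xget x0 [set y | D y /\ i y = k].
have q_dense x (e : R) : (0 < e)%R -> exists k, (mdist x (q k) < e)%R.
  move=> e0; have [oB xB] := open_nbhs_ball x (PosNum e0).
  have [|y [yB Dy]] := dD _ _ oB; first by exists x.
  exists (i y); rewrite /q; case: xgetP => [z _ [Dz iz]|/(_ y) nD]; last first.
    by exfalso; apply: nD.
  have -> : z = y by apply: iD; rewrite ?inE.
  by have := interior_subset yB; rewrite ballEmdist.
exists (encode q \o f), (f' \o decode q x0); split.
- apply: measurable_to_prod => m; apply: measurable_pred_fun; rewrite /encode /=.
  case: (@unpickle (nat * nat)%type m) => [[n k]|]; last first.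
    by rewrite (_ : [set x | _] = set0)//; apply/seteqP; split.
  apply/fB; apply: sub_sigma_algebra.
  rewrite (_ : f @` _ = [set y | (mdist y (q k) < 2^-1 ^+ n)%R]); last first.
    apply/seteqP; split=> [_ [x xk <-]//|y yk]; exists (f' y); rewrite /mkset f'K//.
  rewrite openE => y yk; apply/nbhs_ballP.
  exists (2^-1 ^+ n - mdist y (q k))%R; first by rewrite /= subr_gt0.
  move=> z; rewrite ballEmdist /= => yz.
  have tr := metric_triangle z y (q k); apply: le_lt_trans tr _.
  by rewrite metric_sym; lra.
- move=> _ A mA; rewrite setTI.
  have -> : (f' \o decode q x0) @^-1` A = decode q x0 @^-1` (f @` A).
    apply/seteqP; split=> b /=; first by move=> Ab; exists (f' (decode q x0 b)).
    by move=> [x Ax <-]; rewrite fK.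
  by apply: measurable_decode => //; exact/fB.
- by move=> x /=; rewrite decode_encode.
Qed.

(** * Bernoulli shifts *)

(** If all events had probability 0 or 1, each bit of [h] would be almost surely constant, hence so
    would [h]; as [h] is injective, [kappa] would be supported on a point. *)
Lemma exists_intermediate_probability (R : realType) d (K : measurableType d)
    (kappa : probability K R) : standard_borel R K -> ~ single_point_supported kappa ->
  exists (A : set K) (p : R), [/\ measurable A, kappa A = p%:E & (0 < p < 1)%R].
Proof.
move=> /standard_borel_retract[h [g [mh _ hK]]] nsingle; apply: contrapT => nA.
have zero_one A : measurable A -> kappa A = 0 \/ kappa A = 1.
  move=> mA; apply: contrapT => /not_orP[k0 k1]; apply: nA.
  have fin : kappa A \is a fin_num by exact: fin_num_measure.
  exists A, (fine (kappa A)); rewrite fineK//; split=> //; apply/andP; split.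
    by rewrite -lte_fin fineK// lt_neqAle measure_ge0 andbT eq_sym; apply/eqP.
  by rewrite -lte_fin fineK// lt_neqAle probability_le1// andbT; apply/eqP.
have mbit n b : measurable [set x | h x n = b].
  rewrite (_ : [set x | _] = (fun x => h x n) @^-1` [set b])//.
  by rewrite -[_ @^-1` _]setTI; apply: (measurableT_comp (measurable_coord n) mh).
pose b n : bool := `[< kappa [set x | h x n = true] = 1 >].
have b0 n : kappa [set x | h x n = ~~ b n] = 0.
  rewrite /b; case: asboolP => [k1|k1] /=; last first.
    by have [|] := zero_one _ (mbit n true).
  rewrite (_ : [set x | _] = ~` [set x | h x n = true]).
    by rewrite probability_setC// k1 subee.
  by apply/seteqP; split=> x /=; case: (h x n).
pose N := \bigcup_n [set x | h x n = ~~ b n].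
have mN : measurable N by exact: bigcupT_measurable.
have N0 : kappa N = 0.
  apply: measure_negligible => //; apply: negligible_bigcup => n.
  by apply/negligibleP; [exact: mbit|exact: b0].
have NC1 : kappa (~` N) = 1 by rewrite probability_setC// N0 sube0.
have [x Nx] : exists x, (~` N) x.
  apply: contrapT => /forallNP none; move: NC1.
  by rewrite (_ : ~` N = set0) ?measure0 => [/esym/eqP|]; [rewrite onee_eq0|apply/seteqP; split].
(* The set where every bit takes its almost sure value is exactly the singleton of [x]. *)
apply: nsingle; exists x; rewrite -NC1; congr (kappa _).
have hb y n : (~` N) y -> h y n = b n.
  move=> Ny; apply/eqP; apply: contrapT => hn; apply: Ny; exists n => //=.
  by move: hn; case: (h y n); case: (b n).
apply/seteqP; split=> [y -> //|y Ny] /=.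
by rewrite -(hK x) -(hK y); congr g; apply/funext => n; rewrite !hb.
Qed.

(** Of the source only an event of intermediate probability is used. On the target side, coins
    simulate the law [rho] of the code [h] under [lambda], and [g] decodes it. *)
Lemma has_bernoulli_factor_map (R : realType) (G : countGroupType)
    (hG : contains_nonabelian_free_subgroup G) (dK dL : measure_display)
    (K : measurableType dK) (L : measurableType dL)
    (kappa : probability K R) (lambda : probability L R) :
  standard_borel R K -> ~ single_point_supported kappa -> standard_borel R L ->
  has_factor_map (bernoulli_shift G kappa) (bernoulli_shift G lambda).
Proof.
move=> hK hkappa /standard_borel_retract[h [g [mh mg hgK]]].
have [A [p [mA kA p01]]] := exists_intermediate_probability hK hkappa.
have [rho rhoE] : exists rho : probability (prod_space nat bool) R,
    forall B, rho B = lambda (h @^-1` B).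
  by exists (distribution lambda (mfun_Sub (mem_set mh : h \in mfun))).
have [theta [mtheta thetaE]] := coin_universal rho.
apply: (has_factor_map_of_fair_bits hG mA kA p01 (measurableT_comp mg mtheta)) => B mB.
rewrite [(g \o theta) @^-1` B](comp_preimage B theta g) thetaE; last first.
  by rewrite -[_ @^-1` _]setTI; exact: mg.
rewrite rhoE -comp_preimage; congr (lambda _).
by apply/seteqP; split=> x /=; rewrite hgK.
Qed.

Theorem theorem1p1 (R : realType) (G : countGroupType)
    (hG : contains_nonabelian_free_subgroup G)
    (dK dL : measure_display) (K : measurableType dK) (L : measurableType dL)
    (hK : standard_borel R K) (hL : standard_borel R L)
    (kappa : probability K R) (lambda : probability L R)
    (hkappa : ~ single_point_supported kappa)
    (hlambda : ~ single_point_supported lambda) :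
  weakly_isomorphic (bernoulli_shift G kappa) (bernoulli_shift G lambda).
Proof. by split; exact: has_bernoulli_factor_map. Qed.
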